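(* Let $\mathcal{T}$ be a compact $3$-manifold triangulation built from $n$ tetrahedra. The canonical part of every quadrilateral vertex normal surface in $\mathcal{T}$ is also a standard vertex normal surface in $\mathcal{T}$.
   Context: Triangulations. A compact $3$-manifold triangulation $\mathcal{T}$ is a finite collection of tetrahedra $\Delta_1,\ldots,\Delta_n$, some or all of whose $4n$ faces are affinely identified in pairs, such that the resulting topological space is a compact $3$-manifold (possibly with boundary). Different vertices (or edges, or faces) of the same tetrahedron may be identified. Vertices, edges and faces of $\mathcal{T}$ are equivalence classes of tetrahedron vertices, edges and faces. A face not identified with another is a boundary face; boundary edges are those lying in the boundary. Normal surfaces. A normal disc in a tetrahedron is a properly embedded disc missing the vertices, whose boundary consists of either three arcs across three different faces (a triangle) or four arcs across all four faces (a quadrilateral). There are seven types per tetrahedron: four triangle types (each surrounding one vertex) and three quadrilateral types (each separating one pair of opposite edges). An embedded normal surface in $\mathcal{T}$ is a properly embedded surface (possibly disconnected or empty) meeting each tetrahedron in a (possibly empty) collection of disjoint normal discs; surfaces are identified up to normal isotopy (ambient isotopy preserving each simplex). For a vertex $V$, the vertex link $\ell(V)$ is the normal surface at the frontier of a small regular neighbourhood of $V$; it contains one copy of each triangular disc type surrounding $V$ and nothing else. The canonical part $\kappa_s(S)$ of an embedded normal surface $S$ is the surface obtained by removing all vertex linking components from $S$. Vectors. If $S$ has $t_{i,j}$ triangles of the $j$th type and $q_{i,k}$ quadrilaterals of the $k$th type in $\Delta_i$, then $\mathbf{v}(S)=(t_{1,1},t_{1,2},t_{1,3},t_{1,4},q_{1,1},q_{1,2},q_{1,3};\ldots,q_{n,3})\in\mathbb{R}^{7n}$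 and $\mathbf{q}(S)=(q_{1,1},q_{1,2},q_{1,3};\ldots,q_{n,3})\in\mathbb{R}^{3n}$. The projective image of $\mathbf{x}\ne\mathbf{0}$ is $\overline{\mathbf{x}}=\mathbf{x}/\sum x_i$, and $\overline{\mathbf{0}}=\mathbf{0}$. Standard matching equations (on $\mathbb{R}^{7n}$): for each non-boundary face $F$ and each edge $e$ of $F$, let $\Delta_i,\Delta_j$ be the two tetrahedra joined along $F$. In each there is exactly one triangle type and one quadrilateral type meeting $F$ in an arc parallel to $e$; if these have coordinates $t_{i,a},q_{i,b}$ and $t_{j,c},q_{j,d}$, the equation is $t_{i,a}+q_{i,b}=t_{j,c}+q_{j,d}$. Quadrilateral matching equations (on $\mathbb{R}^{3n}$): for each non-boundary edge $e$, the tetrahedra containing $e$ are arranged in a cycle $\Delta_{i_1},\ldots,\Delta_{i_k}$ around $e$. Choose a direction around the cycle and label the ends of $e$ upper and lower. In each of these tetrahedra two quadrilateral types meet $e$: the upward one, rising from the lower end to the upper end as we move around the cycle (it cuts off the lower end of $e$ in the face through which we enter the tetrahedron and the upper end in the face through which we leave), and the downward one, falling in the opposite direction. With upward coordinates $q_{i_1,u_1},\ldots,q_{i_k,u_k}$ and downward coordinates $q_{i_1,d_1},\ldots,q_{i_k,d_k}$, the equation is $\sum_s q_{i_s,u_s}=\sum_s q_{i_s,d_s}$. Vertex normal surfaces. The standard (resp. quadrilateral) projective solution space $\mathscr{S}(\mathcal{T})\subset\mathbb{R}^{7n}$ (resp. $\mathscr{Q}(\mathcal{T})\subset\mathbb{R}^{3n}$)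 is the polytope of all vectors with non-negative coordinates summing to $1$ that satisfy the standard (resp. quadrilateral) matching equations. An embedded normal surface $S$ is a standard vertex normal surface if $\overline{\mathbf{v}(S)}$ is a vertex of $\mathscr{S}(\mathcal{T})$, and a quadrilateral vertex normal surface if $\overline{\mathbf{q}(S)}$ is a vertex of $\mathscr{Q}(\mathcal{T})$. *)

(* Defs.v *)
From HB Require Import structures.
From Stdlib Require Import Relations.
From mathcomp Require Import all_boot all_order all_algebra all_fingroup.
From mathcomp Require Import finmap generic_quotient.
From mathcomp Require Import boolp classical_sets functions cardinality.
From mathcomp Require Import set_interval reals topology normedtype.

Set Implicit Arguments.
Unset Strict Implicit.
Unset Printing Implicit Defensive.

Import Order.TTheory GRing.Theory Num.Theory.
Import numFieldNormedType.Exports.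
Local Open Scope classical_set_scope.
Local Open Scope ring_scope.
Local Open Scope quotient_scope.

(* Vertices of a tetrahedron are numbered by 'I_4, and face f is the one        *)
(* opposite vertex f. [gluing i f = Some (j, p)] says that face f of            *)
(* tetrahedron i is identified with face [p f] of tetrahedron j by the affine   *)
(* map taking vertex a to vertex [p a] for each a != f; as [p f] records the    *)
(* image face, p is determined by the identification. [None] is a boundary      *)
(* face.                                                                        *)
Record triangulation (n : nat) := Triangulation {
  gluing : 'I_n -> 'I_4 -> option ('I_n * 'S_4);
  gluing_sym : forall i f j p,
    gluing i f = Some (j, p) -> gluing j (p f) = Some (i, (p^-1)%g);
  gluing_irr : forall i f j p,
    gluing i f = Some (j, p) -> (j, p f) <> (i, f) }.

(* Points of the standard 3-simplex, in barycentric coordinates.                *)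
Definition simplex (R : realType) : set 'rV[R]_4 :=
  [set x : 'rV[R]_4 | (forall a, 0 <= x 0 a) /\ \sum_a x 0 a = 1].

Definition tet (R : realType) : topologicalType := set_type (@simplex R).

Definition bary (R : realType) (x : tet R) (a : 'I_4) : R := (val x : 'rV[R]_4) 0 a.

(* The vertex set of the open face (of any dimension) containing x.             *)
Definition carrier (R : realType) (x : tet R) : {set 'I_4} :=
  [set a | bary x a != 0]%SET.

Definition tets (R : realType) (n : nat) : topologicalType :=
  {i : 'I_n & (fun=> tet R) i}.

Section Realization.
Variables (R : realType) (n : nat) (T : triangulation n).

Definition glued (x y : tets R n) : Prop :=
  exists f p, [/\ bary (projT2 x) f = 0,
                  gluing T (projT1 x) f = Some (projT1 y, p) &
                  forall a, bary (projT2 y) (p a) = bary (projT2 x) a].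

Definition glue_rel (x y : tets R n) : bool := `[< clos_refl_sym_trans _ glued x y >].

Lemma glue_rel_refl : reflexive glue_rel.
Proof. by move=> x; apply/asboolP; apply: rst_refl. Qed.

Lemma glue_rel_sym : symmetric glue_rel.
Proof.
by move=> x y; apply/idP/idP => /asboolP h; apply/asboolP; apply: rst_sym.
Qed.

Lemma glue_rel_trans : transitive glue_rel.
Proof.
move=> y x z /asboolP h1 /asboolP h2; apply/asboolP.
exact: rst_trans h1 h2.
Qed.

Definition glue_equiv := EquivRel _ glue_rel_refl glue_rel_sym glue_rel_trans.

(* The topological space obtained from n tetrahedra by the identifications.     *)
Definition realization := {eq_quot glue_equiv}.

HB.instance Definition _ := Topological.copy realization (quotient_topology realization).
HB.instance Definition _ := Quotient.on realization.

Definition pt (i : 'I_n) (x : tet R) : realization :=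
  \pi_realization (existT (fun=> tet R) i x : tets R n).

End Realization.

Section Manifold.
Variables (R : realType) (M : topologicalType).

Definition half_space : set 'rV[R]_3 := [set x : 'rV[R]_3 | 0 <= x 0 ord_max].

(* phi is a homeomorphism, with inverse psi, from the open set U onto a         *)
(* relatively open subset of the half-space.                                    *)
Definition chart (U : set M) (phi : M -> 'rV[R]_3) (psi : 'rV[R]_3 -> M) : Prop :=
  [/\ open U, {within U, continuous phi}, {within phi @` U, continuous psi},
      {in U, cancel phi psi} &
      exists2 W, open W & phi @` U = W `&` half_space].

Definition compact_3manifold : Prop :=
  [/\ compact [set: M], hausdorff_space M, @second_countable M &
      forall p : M, exists U phi psi, chart U phi psi /\ U p].

(* Locally S looks like a plane perpendicular to the boundary of the            *)
(* half-space, so S is a surface whose boundary is its intersection with the    *)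
(* boundary of M.                                                               *)
Definition properly_embedded_surface (S : set M) : Prop :=
  compact S /\
  forall p, S p -> exists U phi psi,
    [/\ chart U phi psi, U p &
        phi @` (U `&` S) = phi @` U `&` [set x : 'rV[R]_3 | x 0 ord0 = 0]].

End Manifold.

Section NormalDiscs.
Variable R : realType.

Definition embedding_on (X Y : topologicalType) (A : set X) (h : X -> Y) : Prop :=
  {within A, continuous h} /\ {in A &, injective h}.

Definition disc2 : set 'rV[R]_2 :=
  [set x : 'rV[R]_2 | x 0 0 ^+ 2 + x 0 1 ^+ 2 <= 1].
Definition circle1 : set 'rV[R]_2 :=
  [set x : 'rV[R]_2 | x 0 0 ^+ 2 + x 0 1 ^+ 2 = 1].

(* A is an arc in face f from x to y, which lie in the interiors of different   *)
(* edges of f, and the rest of A lies in the interior of f.                     *)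
Definition arc_across (f : 'I_4) (x y : tet R) (A : set (tet R)) : Prop :=
  [/\ [/\ bary x f = 0, bary y f = 0, #|carrier x| = 2%N, #|carrier y| = 2%N &
          carrier x != carrier y],
      forall z, A z -> z <> x -> z <> y -> carrier z = [set~ f]%SET &
      exists g : R -> tet R,
        [/\ @embedding_on R (tet R) `[0, 1] g, g 0 = x, g 1 = y & A = g @` `[0, 1]]].

(* The boundary arcs are listed in cyclic order: the k-th one lies in face f k, *)
(* and runs from x k to the start of the next one.                              *)
Definition normal_disc (D : set (tet R)) : Prop :=
  exists h : 'rV[R]_2 -> tet R,
    [/\ embedding_on disc2 h,
        D = h @` disc2,
        forall u, disc2 u -> (carrier (h u) != [set: 'I_4]%SET <-> circle1 u),
        forall z, D z -> (1 < #|carrier z|)%N &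
        exists (m : nat) (f : 'I_m -> 'I_4) (x : 'I_m -> tet R)
               (A : 'I_m -> set (tet R)),
          [/\ (m == 3%N) || (m == 4%N), injective f,
              forall k, arc_across (f k) (x k) (x (ordS k)) (A k) &
              h @` circle1 = \bigcup_k A k]].

(* The type of a normal disc is determined by the edges that it crosses: those  *)
(* joining a vertex in X to one outside X, where X consists of the surrounded   *)
(* vertex of a triangle, or of the ends of one of the two opposite edges that a *)
(* quadrilateral separates.                                                     *)
Definition cuts_off (D : set (tet R)) (X : {set 'I_4}) : Prop :=
  forall a b : 'I_4, a != b ->
    ((exists2 z, D z & carrier z = [set a; b]%SET) <-> (a \in X) != (b \in X)).

End NormalDiscs.

(* The k-th quadrilateral type separates the edge joining vertices 0 and k + 1  *)
(* from the opposite edge.                                                      *)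
Definition quad_side (k : 'I_3) : {set 'I_4} := [set ord0; lift ord0 k]%SET.

(* For a != b this holds for exactly one k.                                     *)
Definition same_side (k : 'I_3) (a b : 'I_4) : bool :=
  (a \in quad_side k) == (b \in quad_side k).

Section NormalSurfaces.
Variables (R : realType) (n : nat) (T : triangulation n).
Implicit Type S : set (realization R T).

Definition trace S (i : 'I_n) : set (tet R) := [set x | S (pt T i x)].

(* As the normal discs in a tetrahedron are disjoint, and finite in number,     *)
(* they are the connected components of their union.                            *)
Definition discs S (i : 'I_n) : set (set (tet R)) :=
  connected_component (trace S i) @` trace S i.

Definition normal_surface S : Prop :=
  properly_embedded_surface R S /\
  forall i, finite_set (discs S i) /\ forall D, discs S i D -> normal_disc D.

Definition count_discs S (i : 'I_n) (X : {set 'I_4}) : nat :=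
  #|` fset_set [set D | discs S i D /\ cuts_off D X]|%fset.

Definition quad_vector S : 'M[R]_(n, 3) :=
  \matrix_(i, k) (count_discs S i (quad_side k))%:R.

(* Row i holds the 4 triangle, then the 3 quadrilateral coordinates of          *)
(* tetrahedron i.                                                               *)
Definition std_vector S : 'M[R]_(n, 4 + 3) :=
  row_mx (\matrix_(i, a) (count_discs S i [set a]%SET)%:R) (quad_vector S).

Definition is_corner (V : realization R T) (i : 'I_n) (a : 'I_4) : Prop :=
  exists2 x, carrier x = [set a]%SET & pt T i x = V.

Definition link_vector (V : realization R T) : 'M[R]_(n, 4 + 3) :=
  row_mx (\matrix_(i, a) `[< is_corner V i a >]%:R) 0.

Definition vertex_linking S : Prop :=
  normal_surface S /\
  exists V, (exists i a, is_corner V i a) /\ std_vector S = link_vector V.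

Definition canonical_part S : set (realization R T) :=
  [set p | S p /\ ~ vertex_linking (connected_component S p)].

End NormalSurfaces.

Section Matching.
Variables (R : realType) (n : nat) (T : triangulation n).

(* The coordinates of the triangles and quadrilaterals of tetrahedron i that    *)
(* meet face f in an arc cutting off its vertex a.                              *)
Definition arc_count (x : 'M[R]_(n, 4 + 3)) (i : 'I_n) (f a : 'I_4) : R :=
  lsubmx x i a + \sum_(k | same_side k f a) rsubmx x i k.

Definition std_matching (x : 'M[R]_(n, 4 + 3)) : Prop :=
  forall i f j p a, gluing T i f = Some (j, p) -> a != f ->
    arc_count x i f a = arc_count x j (p f) (p a).

(* A pair (i, s) is an edge of tetrahedron i, with lower end [s 0] and upper    *)
(* end [s 1], and a direction around it: we enter through face [s 2] and leave  *)
(* through face [s 3]. Then [turn] goes to the next tetrahedron around the      *)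
(* edge; recall that products of permutations apply the left factor first.      *)
Definition turn : rel ('I_n * 'S_4) := fun x y =>
  if gluing T x.1 (x.2 3) is Some (j, p)
  then y == (j, tperm 2 3 * x.2 * p)%g else false.

(* In the entry face, with vertices [s 0], [s 1], [s 3], the upward             *)
(* quadrilateral cuts off [s 0], so it has [s 0] and [s 2] on the same side.    *)
Definition quad_matching (q : 'M[R]_(n, 3)) : Prop :=
  forall c : seq ('I_n * 'S_4), ucycle turn c ->
    \sum_(x <- c) \sum_(k | same_side k (x.2 0) (x.2 2)) q x.1 k =
    \sum_(x <- c) \sum_(k | same_side k (x.2 0) (x.2 3)) q x.1 k.

End Matching.

Section Polytopes.
Variables (R : realType) (m d : nat).

Definition coord_sum (x : 'M[R]_(m, d)) : R := \sum_i \sum_j x i j.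

(* As 0^-1 = 0, this maps 0 to 0.                                               *)
Definition projective_image (x : 'M[R]_(m, d)) : 'M[R]_(m, d) :=
  (coord_sum x)^-1 *: x.

Definition solution_space (matching : 'M[R]_(m, d) -> Prop) : set 'M[R]_(m, d) :=
  [set x : 'M_(m, d) |
    [/\ forall i j, 0 <= x i j, coord_sum x = 1 & matching x]].

Definition polytope_vertex (P : set 'M[R]_(m, d)) (x : 'M[R]_(m, d)) : Prop :=
  P x /\ forall y z (t : R), P y -> P z -> 0 < t < 1 ->
    x = t *: y + (1 - t) *: z -> y = x /\ z = x.

End Polytopes.

Section VertexSurfaces.
Variables (R : realType) (n : nat) (T : triangulation n) (S : set (realization R T)).

Definition std_vertex_surface : Prop :=
  normal_surface S /\
  polytope_vertex (solution_space (std_matching (R := R) T))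
    (projective_image (std_vector S)).

Definition quad_vertex_surface : Prop :=
  normal_surface S /\
  polytope_vertex (solution_space (quad_matching (R := R) T))
    (projective_image (quad_vector S)).

End VertexSurfaces.

(* Main.v *)
Require Import Defs.
From Stdlib Require Import Relations.
From mathcomp Require Import all_boot all_order all_algebra all_fingroup.
From mathcomp Require Import finmap generic_quotient.
From mathcomp Require Import boolp classical_sets cardinality.
From mathcomp Require Import reals topology normedtype.
From mathcomp Require Import lra zify.

(** Write K for the canonical part of S. A vertex linking component carries no
    quadrilaterals, so v(K) has quadrilateral part q(S).

    Suppose that v(K), normalised to X, is a proper convex combination X = a + b
    of nonnegative multiples a, b of points of the standard solution space.
    Adding up standard matching equations around an edge cancels the triangle
    coordinates, so the quadrilateral parts of a and b solve the quadrilateral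
    matching equations ([quad_of_std_matching]). As q(S) spans an extreme ray of
    that cone ([extreme_ray]), they are al and 1 - al times that of X. Thus
    d = a - al X and b - (1 - al) X are solutions without quadrilaterals. The
    matching equations make the triangle coordinates of such a solution constant
    around each vertex of the triangulation ([corner_constant]). Around each
    vertex there is a corner at which K has no triangle ([canonical_gap]), and
    there d is a coordinate of a, so nonnegative; hence d >= 0 everywhere
    ([dominated_by_gap]), likewise b - (1 - al) X >= 0, and as these two vectors
    add up to 0 both vanish. So a and b are multiples of X, and X is a vertex.

    Two geometric facts are needed. The first is that v(K) satisfies the standard
    matching equations ([normal_std_matching]). The number of points in which a
    surface meets an edge does not depend on the tetrahedron in which they are
    counted, and the numbers of arcs in a face are determined by the numbers of
    points on its three edges.

    The second is [canonical_gap]. If a normal surface has a triangle at every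
    corner of a vertex V, take at each corner the three points of the surface
    nearest to the corner on its edges. They lie on one disc ([nearest_same_disc]),
    which is then a triangle, and these nearest triangles match across faces and
    form a component of the surface that links V ([vertex_link_component]); the
    canonical part has no such component. That the three nearest points lie on one
    disc is where planarity enters: otherwise two disjoint arcs in a face would
    have interlaced ends. The proof that such arcs meet ([arcs_cross]) applies
    Sperner's lemma to the difference of two parametrisations.

    Components are handled through discs. A surface is a finite union of compact
    connected discs, so a union of discs that contains every disc it meets is
    closed, with closed complement, and inherits normality ([saturated_normal]). *)

Set Implicit Arguments.
Unset Strict Implicit.
Unset Printing Implicit Defensive.

Import Order.TTheory GRing.Theory Num.Theory.
Import numFieldNormedType.Exports.
Local Open Scope classical_set_scope.
Local Open Scope ring_scope.

(** * Sperner's lemma on a square grid *)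

Section Sperner.
Implicit Types x y z w : 'I_3.

(** Sperner's doors: the edges whose ends are coloured 0 and 1. Counting them
    modulo 2 is what makes the lemma work. *)
Definition door x y : bool := (x + y == 1 :> nat)%N.

(** A triangle that misses a colour has an even number of doors: with only the
    colours 0 and 1 they count changes along a closed path, and otherwise one of
    these colours is missing. *)
Lemma door_triangle x y z (k : 'I_3) : k != x -> k != y -> k != z ->
  door x y (+) door y z = door x z.
Proof.
rewrite /door -!val_eqE.
case: x y z k => [[|[|[|//]]] ?] [[|[|[|//]]] ?] [[|[|[|//]]] ?] [[|[|[|//]]] ?] //.
Qed.

Lemma door_path (f : nat -> 'I_3) N : (forall j, (j <= N)%N -> f j != 2%R) ->
  \big[addb/false]_(j < N) door (f j) (f j.+1) = (f 0%N != f N).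
Proof.
elim: N => [|N IH] fN2; first by rewrite big_ord0 eqxx.
rewrite big_ord_recr IH /=; last by move=> j jN; apply/fN2/leqW.
move: (fN2 0%N (leq0n _)) (fN2 N (leqnSn _)) (fN2 N.+1 (leqnn _)).
rewrite /door -!val_eqE.
by case: (f 0%N) (f N) (f N.+1) => [[|[|[|//]]] ?] [[|[|[|//]]] ?] [[|[|[|//]]] ?].
Qed.

(** The parity of the number of doors on the vertical line i does not change from
    i to i + 1, unless some square between the two lines has all three colours:
    both triangles of each square have an even number of doors, and there are no
    doors on the bottom and top sides. On the left side the parity is odd, as the
    colour there is 1 at the bottom and 0 at the top; on the right side, without
    colour 1, it is even. The side conditions are those of Sperner's lemma for the
    triangle with corners (0, 0), (0, N) and (N, 0), with the right and top sides
    of the square as its third side. *)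
Lemma sperner_square (N : nat) (c : nat -> nat -> 'I_3) :
  (forall i, (i <= N)%N -> c i 0%N != 0%R) ->
  (forall j, (j <= N)%N -> c 0%N j != 2%R) ->
  (forall j, (j <= N)%N -> c N j != 1%R) ->
  (forall i, (i <= N)%N -> c i N != 1%R) ->
  exists i j, [/\ (i < N)%N, (j < N)%N & forall k, exists i' j',
    [/\ (i <= i' <= i.+1)%N, (j <= j' <= j.+1)%N & c i' j' = k]].
Proof.
move=> bot lft rgt top; apply: contrapT => no.
pose P i := \big[addb/false]_(j < N) door (c i j) (c i j.+1).
have square i j : (i < N)%N -> (j < N)%N ->
    door (c i j) (c i j.+1) (+) door (c i.+1 j) (c i.+1 j.+1) =
    door (c i j) (c i.+1 j) (+) door (c i j.+1) (c i.+1 j.+1).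
  move=> iN jN; have [k kP] : exists k, forall i' j',
      (i <= i' <= i.+1)%N -> (j <= j' <= j.+1)%N -> k != c i' j'.
    apply: contrapT => nok; apply: no; exists i, j; split=> // k.
    apply: contrapT => kno; apply: nok; exists k => i' j' i'P j'P.
    by apply/eqP => kE; apply: kno; exists i', j'.
  have := door_triangle (kP i j _ _) (kP i j.+1 _ _) (kP i.+1 j.+1 _ _).
  have := door_triangle (kP i j _ _) (kP i.+1 j _ _) (kP i.+1 j.+1 _ _).
  rewrite !leqnn !leqnSn /= => /(_ isT isT isT isT isT isT) E1.
  move=> /(_ isT isT isT isT isT isT) E2.
  move: E1 E2; do 5 case: (door _ _) => //.
have PS i : (i < N)%N -> P i = P i.+1.
  move=> iN.
  have : forall k, (k <= N)%N ->
      \big[addb/false]_(j < k) door (c i j) (c i j.+1) (+)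
      \big[addb/false]_(j < k) door (c i.+1 j) (c i.+1 j.+1) =
      door (c i 0%N) (c i.+1 0%N) (+) door (c i k) (c i.+1 k).
    elim=> [|k IH] kN; first by rewrite !big_ord0 !addbb.
    rewrite !big_ord_recr /=.
    have := square i k iN kN; have := IH (ltnW kN).
    move: (\big[addb/false]_(j < k) door (c i j) _).
    move: (\big[addb/false]_(j < k) door (c i.+1 j) _).
    by do 2 case; do 5 case: (door _ _).
  move=> /(_ N (leqnn _)); rewrite -/(P i) -/(P i.+1).
  have -> : door (c i 0%N) (c i.+1 0%N) = false.
    have := bot i (ltnW iN); have := bot i.+1 iN; rewrite /door -!val_eqE.
    by case: (c i 0%N) (c i.+1 0%N) => [[|[|[|//]]] ?] [[|[|[|//]]] ?].
  have -> : door (c i N) (c i.+1 N) = false.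
    have := top i (ltnW iN); have := top i.+1 iN; rewrite /door -!val_eqE.
    by case: (c i N) (c i.+1 N) => [[|[|[|//]]] ?] [[|[|[|//]]] ?].
  by case: (P i); case: (P i.+1).
have PN : P N = P 0%N.
  by elim: {-2}N (leqnn N) => // k IH kN; rewrite -PS // IH // ltnW.
have P0 : P 0%N = true.
  rewrite /P door_path //; move: (bot 0%N (leq0n _)) (lft 0%N (leq0n _)).
  move: (lft N (leqnn _)) (top 0%N (leq0n _)); rewrite -!val_eqE.
  by case: (c 0%N 0%N) (c 0%N N) => [[|[|[|//]]] ?] [[|[|[|//]]] ?].
move: PN; rewrite P0 /P big1 // => j _.
have := rgt j (ltnW (ltn_ord j)); have := rgt j.+1 (ltn_ord j).
rewrite /door -!val_eqE.
by case: (c N j) (c N j.+1) => [[|[|[|//]]] ?] [[|[|[|//]]] ?].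
Qed.
End Sperner.

(** Where all F k are nonnegative they vanish, and then no colour is positive; so
    near each point of the square some F k is negative. By compactness this holds
    on balls of a uniform radius, but a fine grid coloured by indices k with
    F k positive has a small square that shows all three colours. *)
Lemma no_sperner_labelling (R : realType) (F : 'I_3 -> R * R -> R) :
  (forall k, continuous (F k)) -> (forall p, \sum_k F k p = 0) ->
  (forall s t, 0 <= s <= 1 -> 0 <= t <= 1 -> exists k : 'I_3,
     [/\ t = 0 -> k != 0%R, s = 0 -> k != 2%R, s = 1 \/ t = 1 -> k != 1%R &
         0 < F k (s, t)]) -> False.
Proof.
move=> Fc F0 lab.
pose K : set (R * R) := `[0, 1] `*` `[0, 1].
have Kcov : near_covering K.
  by apply/compact_near_coveringP/compact_setX; apply: segment_compact.
(* P e p: the ball of radius e around p does not show all colours. *)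
pose P (e : R) (p : R * R) := exists k, forall q, ball p e q -> F k q < 0.
have := Kcov R (0^'+) P _.
have FF : Filter (0 : R)^'+ by apply: at_right_proper_filter.
move=> /(_ FF) cov.
have {}cov : \forall e \near (0 : R)^'+, K `<=` P e.
  apply: cov => -[s t] [/=]; rewrite !in_itv /= => s01 t01.
  have [k Fk] : exists k, F k (s, t) < 0.
    apply: contrapT => no; have Fge k : 0 <= F k (s, t).
      by rewrite leNgt; apply/negP => Fk; apply: no; exists k.
    have [k [_ _ _]] := lab s t s01 t01.
    have /eqP := F0 (s, t); rewrite psumr_eq0 // => /allP /(_ k).
    by rewrite mem_index_enum => /(_ isT) /eqP ->; rewrite ltxx.
  have : \forall q \near (s, t), F k q < 0.
    have /= := Fc k (s, t); move/(_ [set x | x < 0]); apply.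
    exact: lt_nbhsl.
  move=> /nbhs_ballP [r /= r0 rP].
  exists (ball (s, t) (r / 2), [set e | 0 < e < r / 2]) => /=.
    split; first by apply: nbhsx_ballx; rewrite divr_gt0.
    near=> e; apply/andP; split; near: e; first exact: nbhs_right_gt.
    by apply: nbhs_right_lt; rewrite divr_gt0.
  move=> [p e] /= [sp /andP[e0 er]]; exists k => q pq; apply: rP => /=.
  rewrite [r]splitr; apply: ball_triangle sp _.
  by apply: le_ball pq; apply: ltW.
have [e [KP e0]] := @filter_ex _ _ (at_right_proper_filter (0 : R)) _
  (filterI cov (nbhs_right_gt (0 : R))).
pose N := (Num.truncn e^-1).+1.
have N0 : 0 < N%:R :> R by rewrite ltr0n.
have Ne : N%:R^-1 < e.
  by rewrite invf_plt ?posrE // truncnS_gt.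
pose g (i : nat) : R := i%:R / N%:R.
have g01 i : (i <= N)%N -> 0 <= g i <= 1.
  move=> iN; rewrite /g divr_ge0 ?ler0n //=.
  by rewrite ler_pdivrMr // mul1r ler_nat.
have gS i i' : (i <= i' <= i.+1)%N -> `|g i - g i'| < e.
  move=> /andP[ii' i'i]; rewrite distrC ger0_norm; last first.
    by rewrite subr_ge0 ler_pM2r ?invr_gt0 // ler_nat.
  rewrite -mulrBl; apply: le_lt_trans Ne.
  rewrite ler_pdivrMr // mulVf ?gt_eqF // lerBlDl.
  by rewrite natr1 ler_nat.
have g0 : g 0%N = 0 by rewrite /g mul0r.
have gN : g N = 1 by rewrite /g divff ?gt_eqF.
have [c cP] : exists c : nat -> nat -> 'I_3, forall i j, (i <= N)%N -> (j <= N)%N ->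
    [/\ g j = 0 -> c i j != 0%R, g i = 0 -> c i j != 2%R,
        g i = 1 \/ g j = 1 -> c i j != 1%R & 0 < F (c i j) (g i, g j)].
  have /choice [c cP] : forall ij : nat * nat, exists k : 'I_3,
    (ij.1 <= N)%N -> (ij.2 <= N)%N ->
    [/\ g ij.2 = 0 -> k != 0%R, g ij.1 = 0 -> k != 2%R,
        g ij.1 = 1 \/ g ij.2 = 1 -> k != 1%R & 0 < F k (g ij.1, g ij.2)].
    move=> [i j] /=; have [iN|iN] := leqP i N; last by exists 0.
    have [jN|jN] := leqP j N; last by exists 0.
    by have [k kP] := lab _ _ (g01 i iN) (g01 j jN); exists k.
  by exists (fun i j => c (i, j)) => i j; apply: (cP (i, j)).
have [|||| i [j [iN jN sq]]] := @sperner_square N c.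
- by move=> i iN; have [+ _ _ _] := cP i 0%N iN isT; apply.
- by move=> j jN; have [_ + _ _] := cP 0%N j isT jN; apply.
- by move=> j jN; have [_ _ + _] := cP N j (leqnn _) jN; apply; left.
- by move=> i iN; have [_ _ + _] := cP i N iN (leqnn _); apply; right.
have [|k kP] := KP (g i, g j).
  by split; rewrite /= in_itv /=; apply: g01; apply: ltnW.
have [i' [j' [ii' jj' ck]]] := sq k.
have [||_ _ _] := cP i' j'; try lia.
rewrite ck ltNge => /negP; apply; apply: ltW; apply: kP.
by split => /=; apply: gS.
Unshelve. all: by end_near.
Qed.

(** * Points and arcs of a tetrahedron *)

Section Tetrahedron.
Variable R : realType.
Implicit Types (x y z : tet R) (a b c d f : 'I_4).

Lemma uniq4_cover (a b c d e : 'I_4) : uniq [:: a; b; c; d] -> e \in [:: a; b; c; d].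
Proof.
move=> u; have /uniq_min_size : uniq [:: a; b; c; d] by [].
move=> /(_ (enum 'I_4)) [] //; first by move=> z; rewrite mem_enum.
  by rewrite -cardE card_ord.
by move=> _ ->; rewrite mem_enum.
Qed.

Lemma uniq4_sum (V : nmodType) (a b c d : 'I_4) (g : 'I_4 -> V) :
  uniq [:: a; b; c; d] -> \sum_e g e = g a + g b + g c + g d.
Proof.
move=> u; rewrite -big_enum /= (perm_big [:: a; b; c; d]) /=.
  by rewrite !big_cons big_nil addr0 !addrA.
apply: uniq_perm => // [|e]; first exact: enum_uniq.
by rewrite mem_enum uniq4_cover.
Qed.

Lemma bary_ge0 x a : 0 <= bary x a.
Proof. by have [+ _] := set_mem (valP x); apply. Qed.

Lemma bary_sum x : \sum_a bary x a = 1.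
Proof. by have [_] := set_mem (valP x). Qed.

Lemma bary_inj x y : bary x =1 bary y -> x = y.
Proof. by move=> xy; apply/val_inj/rowP => a; apply: xy. Qed.

Lemma bary_tet (u : 'I_4 -> R) : (forall a, 0 <= u a) -> \sum_a u a = 1 ->
  exists x, bary x =1 u.
Proof.
move=> u0 u1.
have su : (\row_a u a) \in @simplex R.
  apply/mem_set; split=> [a|]; first by rewrite mxE.
  by rewrite -u1; apply: eq_bigr => a _; rewrite mxE.
by exists (exist (fun v => v \in @simplex R) _ su) => a; rewrite /bary /= mxE.
Qed.

Lemma bary_continuous a : continuous (fun x => bary x a).
Proof.
move=> x; apply: (@continuous_comp (tet R) 'rV[R]_4 R val (fun v => v 0 a)).
  exact: initial_continuous.
exact: coord_continuous.
Qed.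

Lemma in_carrier x a : (a \in carrier x) = (bary x a != 0).
Proof. by rewrite inE. Qed.

Lemma carrier_gt0 x a (A : {set 'I_4}) : carrier x = A -> (0 < bary x a) = (a \in A).
Proof. by move=> <-; rewrite in_carrier lt_neqAle bary_ge0 eq_sym andbT. Qed.

Lemma carrier_eq0 x a (A : {set 'I_4}) : carrier x = A -> a \notin A -> bary x a = 0.
Proof. by move=> <-; rewrite in_carrier negbK => /eqP. Qed.

(** Precomposing with the retraction of R onto [0, 1] turns a path that is
    continuous within [0, 1] into one that is continuous on R. *)
Definition clamp (s : R) : R := Num.max 0 (Num.min 1 s).

Lemma clamp_itv s : 0 <= clamp s <= 1.
Proof. by rewrite /clamp le_max lexx /= ge_max ler01 ge_min lexx. Qed.

Lemma clamp_id s : 0 <= s <= 1 -> clamp s = s.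
Proof. by move=> /andP[s0 s1]; rewrite /clamp min_r // max_r. Qed.

Lemma clamp_continuous : continuous clamp.
Proof.
move=> s; apply: continuous_max; first exact: cst_continuous.
by apply: continuous_min; [exact: cst_continuous | by move=> B].
Qed.

Lemma within_clamp_continuous (Y : topologicalType) (g : R -> Y) :
  {within `[0, 1], continuous g} -> continuous (g \o clamp).
Proof.
move=> /subspace_continuousP gc s.
have cs : clamp s \in `[0, 1] by rewrite in_itv /= clamp_itv.
move=> B gB; have /clamp_continuous := gc _ cs B gB.
apply: (@filterS _ (nbhs s)) => t tB; apply: tB.
by rewrite /= in_itv /= clamp_itv.
Qed.

Lemma arc_across_sym f x y A : arc_across f x y A -> arc_across f y x A.
Proof.
move=> [[xf yf cx cy xy] inA [g [[gc gi] g0 g1 gA]]]; split.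
- by split=> //; rewrite eq_sym.
- by move=> z Az zy zx; apply: inA.
have rev01 s : s \in `[0, 1] -> 1 - s \in `[(0 : R), 1].
  by rewrite !in_itv /= subr_ge0 lerBlDr lerDl => /andP[-> ->].
exists (fun s => g (1 - s)); split.
- split.
    apply/subspace_continuousP => s s01.
    move/subspace_continuousP: gc => /(_ _ (rev01 _ s01)) gc B /gc /= gB.
    have cR : (fun t : R => 1 - t) @ s --> 1 - s.
      by apply: cvgB; [exact: cvg_cst | exact: cvg_id].
    have := cR _ gB; apply: (@filterS _ (nbhs s)) => t tB t01.
    by apply: tB; apply: rev01.
  move=> s t /set_mem s01 /set_mem t01 gst.
  have : 1 - s = 1 - t by apply: gi => //; apply/mem_set/rev01.
  by move=> /addrI /oppr_inj.
- by rewrite subr0.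
- by rewrite subrr.
rewrite gA; apply/seteqP; split=> z /= [s s01 <-].
  by exists (1 - s); [exact: rev01 | rewrite subKr].
by exists (1 - s); [exact: rev01 |].
Qed.

Lemma arc_across_face f x y A z : arc_across f x y A -> A z -> bary z f = 0.
Proof.
move=> [[xf yf _ _ _] inA _] Az.
have [->//|/eqP zx] := eqVneq z x; have [->//|/eqP zy] := eqVneq z y.
by apply: (carrier_eq0 (inA z Az zx zy)); rewrite !inE eqxx.
Qed.

(** The parametrisation of an arc, extended to R so that continuity does not need
    a domain; by injectivity the ends are reached only at the parameters 0 and 1. *)
Lemma arc_across_path f x y A : arc_across f x y A -> exists g : R -> tet R,
  [/\ forall a, continuous (fun s => bary (g s) a), forall s, A (g s),
      g 0 = x, g 1 = y &
      forall s a, 0 < s < 1 -> a != f -> 0 < bary (g s) a].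
Proof.
move=> [_ inA [g [[gc gi] g0 g1 gA]]].
have gAi s : A (g (clamp s)).
  by rewrite gA; exists (clamp s) => //=; rewrite in_itv /= clamp_itv.
have c0 : clamp 0 = 0 by rewrite clamp_id // lexx ler01.
have c1 : clamp 1 = 1 by rewrite clamp_id // lexx ler01.
exists (g \o clamp); split=> //=; rewrite ?c0 ?c1 //.
  move=> a s; apply: (@continuous_comp _ _ _ (g \o clamp) (fun z => bary z a) s).
    exact: within_clamp_continuous.
  exact: bary_continuous.
move=> s a /andP[s0 s1] af; have si : 0 <= s <= 1 by rewrite !ltW.
have ng t : t \in `[0, 1] -> s <> t -> g (clamp s) <> g t.
  move=> t01 st; rewrite clamp_id // => /gi => stE; apply: st; apply: stE.
    by apply/mem_set; rewrite /= in_itv.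
  exact/mem_set.
rewrite (carrier_gt0 _ (inA _ (gAi s) _ _)) ?inE //.
  rewrite -g0; apply: ng; first by rewrite in_itv /= lexx ler01.
  by move=> sE; rewrite sE ltxx in s0.
rewrite -g1; apply: ng; first by rewrite in_itv /= lexx ler01.
by move=> sE; rewrite sE ltxx in s1.
Qed.

(** Two disjoint arcs in the face with vertices a, b, c cannot be interlaced. Here A
    runs from x on ab to y on ac, and B starts at x' on ac, on the side of y towards
    a, and ends at y' which lies beyond x, on ab or on bc. If A and B were disjoint,
    the difference of their barycentric coordinates, as a function on the square of
    pairs of parameters, would vanish nowhere, and so have a positive coordinate
    everywhere. On each side of the square one of the arcs stands at an end, which
    fixes the sign of a coordinate there; this gives the boundary conditions of
    Sperner's lemma, with the colours 0, 1, 2 for the vertices a, b, c. *)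
Lemma arcs_cross f a b c x y x' y' A B : uniq [:: f; a; b; c] ->
  arc_across f x y A -> arc_across f x' y' B ->
  carrier x = [set a; b]%SET -> carrier y = [set a; c]%SET ->
  carrier x' = [set a; c]%SET -> bary y a < bary x' a ->
  (carrier y' = [set a; b]%SET /\ bary y' a < bary x a) \/ carrier y' = [set b; c]%SET ->
  A `&` B !=set0.
Proof.
move=> u arcA arcB cx cy cx' yx' cy'.
have : uniq [:: f; a; b; c] by [].
rewrite /= !inE !negb_or => /and4P[/and3P[fa fb fc] /andP[ab ac] bc _].
have [gA [gAc gAA gA0 gA1 gApos]] := arc_across_path arcA.
have [gB [gBc gBB gB0 gB1 gBpos]] := arc_across_path arcB.
apply: contrapT => AB0.
have nAB s t : gA s <> gB t.
  by move=> st; apply: AB0; exists (gA s); split=> //; rewrite st.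
pose v : 'I_3 -> 'I_4 := tnth [tuple a; b; c].
have sumv (F : 'I_3 -> R) : \sum_k F k = F 0%R + F 1%R + F 2%R.
  rewrite !big_ord_recl big_ord0 addr0 addrA.
  by congr (F _ + F _ + F _); apply: val_inj.
have v0 : v 0%R = a by []. have v1 : v 1%R = b by []. have v2 : v 2%R = c by [].
pose F (k : 'I_3) (p : R * R) := bary (gA p.1) (v k) - bary (gB p.2) (v k).
have F0 p : \sum_k F k p = 0.
  have SA := bary_sum (gA p.1); have SB := bary_sum (gB p.2).
  rewrite (uniq4_sum _ u) (arc_across_face arcA) // add0r in SA.
  rewrite (uniq4_sum _ u) (arc_across_face arcB) // add0r in SB.
  by rewrite sumv /F v0 v1 v2; lra.
apply: (@no_sperner_labelling R F) => //.
  move=> k [s t]; apply: cvgB.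
    apply: (@continuous_comp _ _ _ fst (fun s => bary (gA s) (v k))).
      exact: cvg_fst.
    exact: gAc.
  apply: (@continuous_comp _ _ _ snd (fun s => bary (gB s) (v k))).
    exact: cvg_snd.
  exact: gBc.
move=> s t /andP[s0 s1] /andP[t0 t1].
(* As the coordinates of the difference add up to 0 and do not all vanish, some
   coordinate in P is positive as soon as those outside P are nonpositive. *)
have Fpos (P : pred 'I_3) : (exists2 k, ~~ P k & F k (s, t) < 0) \/
    (forall k, P k) -> (forall k, ~~ P k -> F k (s, t) <= 0) ->
    exists k, P k /\ 0 < F k (s, t).
  move=> ex le0; apply: contrapT => no.
  have le k : F k (s, t) <= 0.
    have [Pk|/le0//] := boolP (P k); rewrite leNgt; apply/negP => Fk.
    by apply: no; exists k.
  have : \sum_k - F k (s, t) == 0 by rewrite sumrN F0 oppr0.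
  rewrite psumr_eq0 => [/allP Fz|k _]; last by rewrite oppr_ge0.
  have {}Fz k : F k (s, t) = 0.
    by apply/eqP; rewrite -oppr_eq0; apply: Fz; rewrite mem_index_enum.
  case: ex => [[k _]|allP]; first by rewrite Fz ltxx.
  apply: (nAB s t); apply: bary_inj => e.
  have := uniq4_cover e u; rewrite !inE => /or4P[] /eqP ->.
  - by rewrite (arc_across_face arcA) // (arc_across_face arcB).
  - by apply/eqP; rewrite -subr_eq0 -v0; apply/eqP/(Fz 0%R).
  - by apply/eqP; rewrite -subr_eq0 -v1; apply/eqP/(Fz 1%R).
  - by apply/eqP; rewrite -subr_eq0 -v2; apply/eqP/(Fz 2%R).
have x0 e := carrier_gt0 e cx; have y0 e := carrier_gt0 e cy.
have x0' e := carrier_gt0 e cx'.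
have cxc : bary x c = 0 by apply: (carrier_eq0 cx); rewrite !inE !negb_or eq_sym ac eq_sym bc.
have cyb : bary y b = 0 by apply: (carrier_eq0 cy); rewrite !inE !negb_or eq_sym ab bc.
have cxb' : bary x' b = 0 by apply: (carrier_eq0 cx'); rewrite !inE !negb_or eq_sym ab bc.
have Sx := bary_sum x; have Sy := bary_sum y; have Sx' := bary_sum x'.
rewrite (uniq4_sum _ u) cxc in Sx; rewrite (uniq4_sum _ u) cyb in Sy.
rewrite (uniq4_sum _ u) cxb' in Sx'.
have xf : bary x f = 0 by rewrite -gA0 (arc_across_face arcA).
have yf : bary y f = 0 by rewrite -gA1 (arc_across_face arcA).
have xf' : bary x' f = 0 by rewrite -gB0 (arc_across_face arcB).
have pos (z : R) : 0 <= z <= 1 -> z != 0 -> z != 1 -> 0 < z < 1.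
  by move=> /andP[z0 z1] zn0 zn1; rewrite !lt_neqAle eq_sym zn0 z0 zn1 z1.
have one_neq0 (z : R) : z = 1 -> z = 0 -> False.
  by move=> -> /eqP; rewrite oner_eq0.
have xb : 0 < bary x b by rewrite x0 !inE eqxx orbT.
have xa : 0 < bary x a by rewrite x0 !inE eqxx.
rewrite /F in Fpos *; cbv beta iota; cbn in Fpos.
have [t_0|/eqP tn0] := eqVneq t 0.
  rewrite t_0 gB0 in Fpos *; have [s_1|/eqP sn1] := eqVneq s 1.
    exists 2%R; split=> //; first by move/(one_neq0 _ s_1).
    by rewrite s_1 gA1 v2; lra.
  exists 1%R; split=> //; first by case=> // /esym/eqP; rewrite oner_eq0.
  rewrite v1 cxb' subr0; have [->|sn0] := eqVneq s 0; first by rewrite gA0.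
  by apply: gApos; rewrite 1?eq_sym //; apply: pos => //; [apply/andP | apply/eqP].
have [t_1|/eqP tn1] := eqVneq t 1.
  rewrite t_1 gB1 in Fpos *; have [s_0|/eqP sn0] := eqVneq s 0.
    exists 0%R; split=> //; first by move/eqP; rewrite oner_eq0.
    rewrite s_0 gA0 v0 subr_gt0; case: cy' => [[]//|cy'].
    by rewrite (carrier_eq0 cy') // !inE !negb_or ab ac.
  have [s_1|/eqP sn1] := eqVneq s 1.
    have [||k [k1 Fk]] := Fpos (fun k => k != 1%R).
    - left; exists 1%R => //; rewrite s_1 gA1 v1 cyb sub0r oppr_lt0.
      by case: cy' => [[cy' _]|cy']; rewrite (carrier_gt0 _ cy') !inE eqxx ?orbT.
    - move=> k; rewrite negbK => /eqP ->.
      by rewrite s_1 gA1 v1 cyb sub0r oppr_le0 bary_ge0.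
    by exists k; split=> // /eqP; rewrite oner_eq0.
  have s01 : 0 < s < 1 by apply: pos; [apply/andP | apply/eqP | apply/eqP].
  case: cy' => [[cy' _]|cy'].
    exists 2%R; split=> //; rewrite v2 (carrier_eq0 cy') ?subr0.
      by apply: gApos; rewrite // eq_sym.
    by rewrite !inE !negb_or ![c == _]eq_sym ac bc.
  exists 0%R; split=> //; first by move/eqP; rewrite oner_eq0.
  rewrite v0 (carrier_eq0 cy') ?subr0; first by apply: gApos; rewrite // eq_sym.
  by rewrite !inE !negb_or ab ac.
have t01 : 0 < t < 1 by apply: pos; [apply/andP | apply/eqP | apply/eqP].
have [s_0|/eqP sn0] := eqVneq s 0.
  have [||k [k2 Fk]] := Fpos (fun k => k != 2%R).
  - left; exists 2%R => //; rewrite s_0 gA0 v2 cxc sub0r oppr_lt0.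
    by apply: gBpos; rewrite // eq_sym.
  - move=> k; rewrite negbK => /eqP ->.
    by rewrite s_0 gA0 v2 cxc sub0r oppr_le0 bary_ge0.
  by exists k; split=> //; case=> // /one_neq0 /(_ s_0).
have [s_1|/eqP sn1] := eqVneq s 1.
  have [||k [k1 Fk]] := Fpos (fun k => k != 1%R).
  - left; exists 1%R => //; rewrite s_1 gA1 v1 cyb sub0r oppr_lt0.
    by apply: gBpos; rewrite // eq_sym.
  - move=> k; rewrite negbK => /eqP ->.
    by rewrite s_1 gA1 v1 cyb sub0r oppr_le0 bary_ge0.
  by exists k; split.
by have [||k [_ Fk]] := Fpos predT; [right | | exists k; split=> //; case].
Qed.
End Tetrahedron.

(** * Normal discs *)

Section NormalDisc.
Variable R : realType.
Implicit Types (x y z : tet R) (a b c d f : 'I_4) (D : set (tet R)).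

Lemma sum_squares_continuous (X : topologicalType) (g h : X -> R) :
  continuous g -> continuous h -> continuous (fun v => g v * g v + h v * h v).
Proof.
move=> gc hc x; apply: cvgD; apply: cvgM;
  [exact: gc | exact: gc | exact: hc | exact: hc].
Qed.

Lemma disc2_compact : compact (@disc2 R).
Proof.
pose g (v : 'rV[R]_2) : R := v 0 0 * v 0 0 + v 0 1 * v 0 1.
apply: bounded_closed_compact.
  exists 1; split=> // M M1 v /= v1.
  have v2 i : v 0 i ^+ 2 <= 1.
    move: v1; rewrite /disc2 /=.
    have := sqr_ge0 (v 0 0); have := sqr_ge0 (v 0 1).
    have : v 0 i = v 0 0 \/ v 0 i = v 0 1.
      by case: i => [[|[|//]] h]; [left|right]; congr (v 0 _); apply: val_inj.
    by case=> ->; lra.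
  rewrite /Num.norm /= mx_normrE; apply/bigmax_leP; split=> [|[i j] _ /=].
    by rewrite ltW // (lt_trans ltr01).
  apply: le_trans (ltW M1); rewrite ord1 -(@ler_pXn2r _ 2) ?nnegrE //.
  by rewrite expr1n real_normK ?num_real.
have gc : continuous g.
  by apply: sum_squares_continuous => v; exact: coord_continuous.
have -> : @disc2 R = g @^-1` [set r | r <= 1] by [].
by apply: closed_comp => [v _|]; [exact: gc | exact: closed_le].
Qed.

Lemma ordS_neq m (k : 'I_m) : (m == 3%N) || (m == 4%N) ->
  ordS k != k /\ ordS (ordS k) != k.
Proof.
by case/orP => /eqP mE; subst m; rewrite -!val_eqE /=;
  case: k => [[|[|[|[|//]]]] ?].
Qed.

Lemma set2_eq (a b c d : 'I_4) : a != b ->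
  ([set a; b] == [set c; d])%SET = (a == c) && (b == d) || (a == d) && (b == c).
Proof.
move=> ab; apply/eqP/idP => [E|]; last first.
  by case/orP => /andP[/eqP -> /eqP ->] //; rewrite finset.setUC.
have := set21 a b; have := set22 a b; rewrite E !inE.
by case/orP => /eqP bE /orP[/eqP aE|/eqP aE]; move: ab; rewrite aE bE ?eqxx ?orbT.
Qed.

(** The seven disc types in one index type, so that sums over all types can be
    handled at once; [side] is the set that the disc cuts off. *)
Definition tri_or_quad := ('I_4 + 'I_3)%type.

Definition side (t : tri_or_quad) : {set 'I_4} :=
  match t with inl a => [set a]%SET | inr k => quad_side k end.

Definition separates (X : {set 'I_4}) a b := (a \in X) != (b \in X).

(** This makes the type of a normal disc unique. *)
Lemma side_inj (t t' : tri_or_quad) :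
  (forall a b, a != b -> separates (side t) a b = separates (side t') a b) -> t = t'.
Proof.
pose o (k : nat) (k4 : (k < 4)%N) := Ordinal k4.
move=> E; have := E (@o 0 isT) (@o 1 isT) isT; have := E (@o 0 isT) (@o 2 isT) isT.
have := E (@o 0 isT) (@o 3 isT) isT; have := E (@o 1 isT) (@o 2 isT) isT.
have := E (@o 1 isT) (@o 3 isT) isT; have := E (@o 2 isT) (@o 3 isT) isT.
rewrite /separates; move: t t' {E} => [a|k] [a'|k'] /=; rewrite !inE -!val_eqE /=.
- case: a => [[|[|[|[|//]]]] p]; case: a' => [[|[|[|[|//]]]] p'] //= _ _ _ _ _ _;
  by congr inl; apply: val_inj.
- by case: a => [[|[|[|[|//]]]] p]; case: k' => [[|[|[|//]]] p'] //=.
- by case: k => [[|[|[|//]]] p]; case: a' => [[|[|[|[|//]]]] p'] //=.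
- case: k => [[|[|[|//]]] p]; case: k' => [[|[|[|//]]] p'] //= _ _ _ _ _ _;
  by congr inr; apply: val_inj.
Qed.

Lemma quad_side_cover a b : a != b ->
  exists k, quad_side k = [set a; b]%SET \/ quad_side k = (~: [set a; b])%SET.
Proof.
have [j|] := unliftP ord0 a.
  move=> ->; have [j'|] := unliftP ord0 b => ->; last first.
    by exists j; left; rewrite /quad_side finset.setUC.
  move=> jj'.
  have [k kj kj'] : exists2 k : 'I_3, k != j & k != j'.
    exists (- (j + j'))%R; move: jj'; rewrite (inj_eq lift_inj) -!val_eqE /=.
      by case: j j' => [[|[|[|//]]] ?] [[|[|[|//]]] ?].
    by case: j j' => [[|[|[|//]]] ?] [[|[|[|//]]] ?].
  exists k; right; apply/setP => e; rewrite !inE.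
  have [l|] := unliftP ord0 e => ->; last by rewrite eqxx ![ord0 == _](negbTE (neq_lift _ _)).
  rewrite ![lift ord0 _ == ord0]eq_sym (negbTE (neq_lift _ _)) /=.
  rewrite !(inj_eq lift_inj).
  move: jj' kj kj'; rewrite (inj_eq lift_inj) -!val_eqE.
  by case: j j' k l => [[|[|[|//]]] ?] [[|[|[|//]]] ?] [[|[|[|//]]] ?] [[|[|[|//]]] ?].
have [j'|] := unliftP ord0 b => -> ->; last by rewrite eqxx.
by exists j'; left.
Qed.

Lemma uniq_extend (s : seq 'I_4) : uniq s -> (size s < 4)%N ->
  exists d, uniq (rcons s d).
Proof.
move=> us s4; have [d ds] : exists d, d \notin s.
  apply/existsP; apply: contraLR s4; rewrite negb_exists -leqNgt => /forallP sP.
  rewrite -[X in (X <= _)%N](card_ord 4) cardE; apply: uniq_leq_size (enum_uniq _) _.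
  by move=> d _; have := sP d; rewrite negbK.
by exists d; rewrite rcons_uniq ds.
Qed.

Lemma uniq4_neq (a b c d : 'I_4) : uniq [:: a; b; c; d] ->
  ((((a == b) = false) * ((b == a) = false)) * (((a == c) = false) * ((c == a) = false))
  * (((a == d) = false) * ((d == a) = false)) * (((b == c) = false) * ((c == b) = false))
  * (((b == d) = false) * ((d == b) = false)) * (((c == d) = false) * ((d == c) = false)))%type.
Proof.
rewrite /= !inE !negb_or andbT => /and3P[/and3P[ab ac ad] /andP[bc bd] cd].
by do !split; apply/negbTE; rewrite // eq_sym.
Qed.

Lemma setC_pair (a b c d : 'I_4) : uniq [:: a; b; c; d] ->
  (~: [set a; b] = [set c; d])%SET.
Proof.
move=> u; apply/setP => e; have N := uniq4_neq u; rewrite !inE.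
by have := uniq4_cover e u; rewrite !inE => /or4P[] /eqP ->; rewrite ?eqxx ?N.
Qed.

(** What a cycle of three or four boundary arcs determines about a disc. *)
Section BoundaryArcs.
Variables (D : set (tet R)) (m : nat) (f : 'I_m -> 'I_4) (x : 'I_m -> tet R)
  (A : 'I_m -> set (tet R)).
Hypotheses (m34 : (m == 3%N) || (m == 4%N)) (finj : injective f).
Hypothesis arcs : forall k, arc_across (f k) (x k) (x (ordS k)) (A k).
Hypothesis arcsD : forall k, A k `<=` D.
Hypothesis Darcs : forall z, D z -> carrier z != [set: 'I_4]%SET -> exists k, A k z.

Let arc_start k : A k (x k).
Proof.
have [_ _ [g [_ <- _ ->]]] := arcs k; exists 0 => //=.
by rewrite in_itv /= lexx ler01.
Qed.

Let arc_end k : A k (x (ordS k)).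
Proof.
have [_ _ [g [_ _ <- ->]]] := arcs k; exists 1 => //=.
by rewrite in_itv /= lexx ler01.
Qed.

(* The common end of consecutive arcs lies on both of their faces. *)
Let carrier_x k : carrier (x (ordS k)) = (~: [set f k; f (ordS k)])%SET.
Proof.
have [[_ xk _ cx _] _ _] := arcs k; have [[xk' _ _ _ _] _ _] := arcs (ordS k).
apply/eqP; rewrite eqEcard; apply/andP; split.
  apply/fintype.subsetP => a; rewrite !inE; apply: contra => /orP[] /eqP ->; exact/eqP.
rewrite cx cardsCs finset.setCK card_ord cards2 (inj_eq finj) eq_sym.
by have [-> _] := ordS_neq k m34.
Qed.

Let edge_point z : D z -> #|carrier z| = 2 -> exists k, z = x k.
Proof.
move=> Dz cz; have [|k Akz] := Darcs Dz.
  by apply/eqP => E; move: cz; rewrite E cardsT card_ord.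
have [->|/eqP zx] := eqVneq z (x k); first by exists k.
have [->|/eqP zy] := eqVneq z (x (ordS k)); first by exists (ordS k).
have [_ inA _] := arcs k; move: cz; rewrite inA //.
by rewrite cardsCs finset.setCK card_ord cards1.
Qed.

(** Different pairs of consecutive faces lie on different edges, because m is at
    least 3. *)
Lemma arcs_edge_uniq z z' : D z -> D z' -> #|carrier z| = 2 ->
  carrier z = carrier z' -> z = z'.
Proof.
move=> Dz Dz' c2 cE; have [k zE'] := edge_point Dz c2.
have [|k' zE] := edge_point Dz'; first by rewrite -cE.
move: cE; rewrite zE' zE -[k]ord_predK -[k']ord_predK !carrier_x.
set j := ord_pred k; set j' := ord_pred k' => /finset.setC_inj /eqP.
have fS i : f i != f (ordS i).
  by rewrite (inj_eq finj) eq_sym; have [] := ordS_neq i m34.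
rewrite set2_eq // !(inj_eq finj) => /orP[] /andP[/eqP -> /eqP // jj'].
by have [_ /eqP] := ordS_neq j' m34.
Qed.

Lemma arcs_in_face f0 z z' : D z -> D z' -> #|carrier z| = 2 -> #|carrier z'| = 2 ->
  carrier z != carrier z' -> f0 \notin carrier z -> f0 \notin carrier z' ->
  exists2 A0, A0 `<=` D & arc_across f0 z z' A0.
Proof.
move=> Dz Dz' c2 c2' cE; have [k zE] := edge_point Dz c2.
have [k' zE'] := edge_point Dz' c2'.
rewrite {}zE {}zE' {Dz Dz' c2 c2'} -[k]ord_predK -[k']ord_predK !carrier_x in cE *.
set j := ord_pred k in cE *; set j' := ord_pred k' in cE *.
rewrite !inE !negbK => /orP[/eqP ->|/eqP ->] /orP[/eqP fE|/eqP fE].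
- by move: cE; rewrite (finj fE) eqxx.
- by rewrite (finj fE); exists (A (ordS j')) => //; apply/arc_across_sym/arcs.
- by rewrite -(finj fE); exists (A (ordS j)) => //; rewrite (finj fE).
- by move: cE; rewrite (ordS_inj (finj fE)) eqxx.
Qed.

Lemma arcs_cover_face f0 z : D z -> bary z f0 = 0 -> exists x0 y0 A0,
  [/\ A0 `<=` D, A0 z & arc_across f0 x0 y0 A0].
Proof.
move=> Dz zf; have [|k Akz] := Darcs Dz.
  by apply/eqP => /setP/(_ f0); rewrite in_carrier zf eqxx inE.
suff [k' [<- Az]] : exists k', f k' = f0 /\ A k' z.
  by exists (x k'), (x (ordS k')), (A k').
have [zx|/eqP zx] := eqVneq z (x k).
  have : f0 \notin carrier z by rewrite in_carrier zf eqxx.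
  rewrite zx -[k]ord_predK carrier_x !inE negbK => /orP[] /eqP ->.
    by exists (ord_pred k); split=> //; apply: arc_end.
  by exists (ordS (ord_pred k)); split=> //; apply: arc_start.
have [zy|/eqP zy] := eqVneq z (x (ordS k)).
  have : f0 \notin carrier z by rewrite in_carrier zf eqxx.
  rewrite zy carrier_x !inE negbK => /orP[] /eqP ->.
    by exists k; split=> //; apply: arc_end.
  by exists (ordS k); split=> //; apply: arc_start.
have [_ inA _] := arcs k.
have : f0 \notin carrier z by rewrite in_carrier zf eqxx.
by rewrite inA // !inE negbK => /eqP ->; exists k.
Qed.

(** Three arcs end on the three edges at the vertex opposite the missing face, so
    they cut off that vertex. Four arcs, in faces f 0, f 1, f 2, f 3, end on all edges
    but {f 0, f 2} and {f 1, f 3}, so they separate these two. *)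
Lemma arcs_type : exists t, cuts_off D (side t).
Proof.
have edges a b : a != b -> (exists2 z, D z & carrier z = [set a; b]%SET) <->
    exists k, [set a; b]%SET = (~: [set f k; f (ordS k)])%SET.
  move=> ab; split=> [[z Dz cz]|[k kE]]; last first.
    by exists (x (ordS k)); [exact: arcsD (arc_end k) | rewrite carrier_x kE].
  have [|k zE] := edge_point Dz; first by rewrite cz cards2 ab.
  by exists (ord_pred k); rewrite -cz zE -[k in LHS]ord_predK carrier_x.
have ex3 (P : 'I_3 -> Prop) : (exists k, P k) <-> [\/ P 0%R, P 1%R | P 2%R].
  split=> [[k]|[]]; [|by exists 0%R|by exists 1%R|by exists 2%R].
  case: k => [[|[|[|//]]] p] Pk; [constructor 1|constructor 2|constructor 3];
  by congr P: Pk; apply: val_inj.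
have ex4 (P : 'I_4 -> Prop) : (exists k, P k) <-> [\/ P 0%R, P 1%R, P 2%R | P 3%R].
  split=> [[k]|[]]; [|by exists 0%R|by exists 1%R|by exists 2%R|by exists 3%R].
  case: k => [[|[|[|[|//]]]] p] Pk;
  [constructor 1|constructor 2|constructor 3|constructor 4];
  by congr P: Pk; apply: val_inj.
have fI i j : (i == j) = false -> (f i == f j) = false by rewrite (inj_eq finj).
have cuts_iff (X : {set 'I_4}) (P : 'I_4 -> 'I_4 -> bool) :
    (forall a b, a != b ->
      (exists k, [set a; b]%SET = (~: [set f k; f (ordS k)])%SET) <-> P a b) ->
    (forall a b, a != b -> P a b = ((a \in X) != (b \in X))) -> cuts_off D X.
  by move=> EP PX a b ab; rewrite edges // EP // PX.
case/orP: m34 (m34) => /eqP mE m34'; subst m.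
  have f01 := fI 0%R 1%R erefl; have f02 := fI 0%R 2%R erefl.
  have f12 := fI 1%R 2%R erefl.
  have [d du] : exists d, uniq [:: f 0%R; f 1%R; f 2%R; d].
    by apply: (@uniq_extend [:: _; _; _]) => //; rewrite /= !inE f01 f02 f12.
  exists (inl d) => /=.
  have [S0 S1 S2] : [/\ ordS (0 : 'I_3) = 1%R, ordS (1 : 'I_3) = 2%R &
      ordS (2 : 'I_3) = 0%R] by split; apply: val_inj.
  have N := uniq4_neq du.
  apply: (cuts_iff _ (fun a b => [|| [set a; b] == [set f 2%R; d],
      [set a; b] == [set f 0%R; d] | [set a; b] == [set f 1%R; d]])%SET) => a b ab.
    rewrite ex3 S0 S1 S2 (setC_pair du).
    rewrite (@setC_pair (f 1%R) (f 2%R) (f 0%R) d) ?(@setC_pair (f 2%R) (f 0%R) (f 1%R) d);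
      try by rewrite /= !inE !N.
    by split=> [[] -> |/or3P[] /eqP ->]; rewrite ?eqxx ?orbT //;
      [constructor 1 | constructor 2 | constructor 3].
  move: ab; rewrite !inE; have := uniq4_cover a du; have := uniq4_cover b du.
  by rewrite !inE => /or4P[] /eqP -> /or4P[] /eqP ->;
    rewrite ?eqxx //= => _; rewrite ?set2_eq ?N ?eqxx ?N.
have f01 := fI 0%R 1%R erefl; have f02 := fI 0%R 2%R erefl.
have f03 := fI 0%R 3%R erefl; have f12 := fI 1%R 2%R erefl.
have f13 := fI 1%R 3%R erefl; have f23 := fI 2%R 3%R erefl.
have fu : uniq [:: f 0%R; f 1%R; f 2%R; f 3%R].
  by rewrite /= !inE f01 f02 f03 f12 f13 f23.
have [S0 S1 S2 S3] : [/\ ordS (0 : 'I_4) = 1%R, ordS (1 : 'I_4) = 2%R,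
    ordS (2 : 'I_4) = 3%R & ordS (3 : 'I_4) = 0%R] by split; apply: val_inj.
have N := uniq4_neq fu.
have cut : cuts_off D [set f 0%R; f 2%R]%SET.
  apply: (cuts_iff _ (fun a b => [|| [set a; b] == [set f 2%R; f 3%R],
      [set a; b] == [set f 3%R; f 0%R], [set a; b] == [set f 0%R; f 1%R] |
      [set a; b] == [set f 1%R; f 2%R]])%SET) => a b ab.
    rewrite ex4 S0 S1 S2 S3 (setC_pair fu).
    rewrite (@setC_pair (f 1%R) (f 2%R) (f 3%R) (f 0%R))
      ?(@setC_pair (f 2%R) (f 3%R) (f 0%R) (f 1%R))
      ?(@setC_pair (f 3%R) (f 0%R) (f 1%R) (f 2%R));
      try by rewrite /= !inE !N.
    by split=> [[] -> |/or4P[] /eqP ->]; rewrite ?eqxx ?orbT //;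
      [constructor 1 | constructor 2 | constructor 3 | constructor 4].
  move: ab; rewrite !inE; have := uniq4_cover a fu; have := uniq4_cover b fu.
  by rewrite !inE => /or4P[] /eqP -> /or4P[] /eqP ->;
    rewrite ?eqxx //= => _; rewrite ?set2_eq ?N ?eqxx ?N.
have [|k [kE|kE]] := @quad_side_cover (f 0%R) (f 2%R); first by rewrite f02.
  by exists (inr k); rewrite /= kE.
exists (inr k) => a b ab; apply: iff_trans (cut _ _ ab) _.
by rewrite /= kE !finset.in_setC; case: (a \in _); case: (b \in _).
Qed.
End BoundaryArcs.

(** A normal disc meets the boundary of the tetrahedron in the image of its boundary
    circle, so in these arcs; compactness is inherited from the plane disc. *)
Lemma normal_disc_arcs D : normal_disc D -> compact D /\
  exists (m : nat) (f : 'I_m -> 'I_4) (x : 'I_m -> tet R) (A : 'I_m -> set (tet R)),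
   [/\ (m == 3%N) || (m == 4%N), injective f,
     forall k, arc_across (f k) (x k) (x (ordS k)) (A k),
     forall k, A k `<=` D &
     forall z, D z -> carrier z != [set: 'I_4]%SET -> exists k, A k z].
Proof.
move=> [h [[hc hi] -> hcirc _ [m [f [x [A [m34 finj arcs circ]]]]]]]; split.
  by apply: continuous_compact hc _; exact: disc2_compact.
exists m, f, x, A; split=> // [k z Akz|z [u du <-] cz].
  have : (h @` @circle1 R) z by rewrite circ; exists k.
  by move=> [u cu <-]; exists u => //; rewrite /disc2 /= cu.
have : (h @` @circle1 R) (h u) by exists u => //; apply/hcirc.
by rewrite circ => -[k _ Ak]; exists k.
Qed.

Section Consequences.
Variable D : set (tet R).
Hypothesis nD : normal_disc D.

Lemma normal_disc_compact : compact D.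
Proof. by have [] := normal_disc_arcs nD. Qed.

Lemma normal_disc_type : exists t, cuts_off D (side t).
Proof.
have [_ [m [f [x [A [m34 finj arcs AD DA]]]]]] := normal_disc_arcs nD.
exact: arcs_type m34 finj arcs AD DA.
Qed.

Lemma normal_disc_edge_uniq z z' : D z -> D z' -> #|carrier z| = 2 ->
  carrier z = carrier z' -> z = z'.
Proof.
have [_ [m [f [x [A [m34 finj arcs AD DA]]]]]] := normal_disc_arcs nD.
exact: arcs_edge_uniq m34 finj arcs DA _ _.
Qed.

Lemma normal_disc_arc f0 z z' : D z -> D z' -> #|carrier z| = 2 -> #|carrier z'| = 2 ->
  carrier z != carrier z' -> f0 \notin carrier z -> f0 \notin carrier z' ->
  exists2 A0, A0 `<=` D & arc_across f0 z z' A0.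
Proof.
have [_ [m [f [x [A [m34 finj arcs AD DA]]]]]] := normal_disc_arcs nD.
exact: arcs_in_face m34 finj arcs AD DA _ _ _.
Qed.

Lemma normal_disc_face f0 z : D z -> bary z f0 = 0 -> exists x0 y0 A0,
  [/\ A0 `<=` D, A0 z & arc_across f0 x0 y0 A0].
Proof.
have [_ [m [f [x [A [m34 finj arcs AD DA]]]]]] := normal_disc_arcs nD.
exact: arcs_cover_face m34 finj arcs AD DA _ _.
Qed.

End Consequences.
End NormalDisc.

(** * Unions of components of a normal surface *)

Section Pieces.
Variables (R : realType) (n : nat) (T : triangulation n).
Local Notation M := (realization R T).
Hypothesis hausM : hausdorff_space M.
Implicit Types (S K : set M) (i : 'I_n) (x y : tet R).

Lemma pt_continuous i : continuous (pt T i : tet R -> M).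
Proof.
move=> x; apply: (@continuous_comp _ (tets R n) M (existT (fun=> tet R) i)).
  exact: existT_continuous.
exact: pi_continuous.
Qed.

Lemma pt_surj (p : M) : exists i x, p = pt T i x.
Proof.
by exists (projT1 (repr p)), (projT2 (repr p)); rewrite /pt -sigT_eta reprK.
Qed.

(** K and its complement in S are both closed, so they separate S. *)
Lemma connected_meets (X : topologicalType) (S K C : set X) :
  K `<=` S -> closed K -> closed (S `\` K) -> C `<=` S -> connected C ->
  C `&` K !=set0 -> C `<=` K.
Proof.
move=> KS cK cSK CS Cc [p [Cp Kp]].
have sep : separated K (S `\` K).
  rewrite /separated -(closure_id K).1 // -(closure_id _).1 //.
  by split; rewrite setIDA; apply/seteqP; split=> q // [[]].
have [|//|CSK] := connected_subset sep _ Cc; last by have [] := CSK p Cp.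
by move=> q /CS Sq; have [|] := pselect (K q); [left | right].
Qed.

Lemma disc_refl S i x : trace S i x -> connected_component (trace S i) x x.
Proof. exact: connected_component_refl. Qed.

Lemma disc_of_point S i x : trace S i x -> discs S i (connected_component (trace S i) x).
Proof. by exists x. Qed.

Lemma discE S i D x : discs S i D -> D x -> D = connected_component (trace S i) x.
Proof. by move=> [y Sy <-] yx; apply: same_connected_component. Qed.

Lemma disc_sub S i D : discs S i D -> D `<=` trace S i.
Proof. by move=> [y Sy <-]; exact: connected_component_sub. Qed.

Lemma disc_connected S i D : discs S i D -> connected D.
Proof. by move=> [y Sy <-]; exact: component_connected. Qed.

Lemma pt_connected i (C : set (tet R)) : connected C -> connected (pt T i @` C).
Proof.
move=> Cc; apply: connected_continuous_connected => //.
exact/continuous_subspaceT/pt_continuous.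
Qed.

(** Such a K is a union of discs of S, which holds of a union of components of S, but
    can be checked one tetrahedron at a time. *)
Definition disc_saturated S K := K `<=` S /\
  forall i D, discs S i D -> D `&` trace K i !=set0 -> D `<=` trace K i.

Lemma disc_saturatedD S K : disc_saturated S K -> disc_saturated S (S `\` K).
Proof.
move=> [KS sat]; split=> [p []//|i D dD [x [Dx [_ Kx]]] y Dy].
split; first exact: (disc_sub dD) Dy.
by move=> Ky; apply: Kx; apply: (sat i D) => //; exists y.
Qed.

Lemma component_saturated S K : K `<=` S ->
  (forall p q, K p -> connected_component S p q -> K q) -> disc_saturated S K.
Proof.
move=> KS sat; split=> // i D dD [x [Dx Kx]] y Dy; apply: (sat _ _ Kx).
exists (pt T i @` D); last by exists y.
split; first by exists x.
  by move=> _ [z /(disc_sub dD) Sz <-].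
exact/pt_connected/(disc_connected dD).
Qed.

(** K is a finite union of images of discs, each of them compact. *)
Lemma disc_saturated_closed S K : normal_surface S -> disc_saturated S K -> closed K.
Proof.
move=> [_ nS] [KS sat].
have -> : K = \bigcup_(i in [set: 'I_n])
    \bigcup_(D in [set D | discs S i D /\ D `<=` trace K i]) (pt T i @` D).
  apply/seteqP; split=> [p Kp|p [i _ [D [_ DK] [x /DK Kx <-]]] //].
  have [i [x pE]] := pt_surj p; exists i => //.
  have Sx : trace S i x by apply: KS; rewrite -pE.
  exists (connected_component (trace S i) x); last first.
    by exists x => //; exact: disc_refl.
  split; first exact: disc_of_point.
  apply: sat; first exact: disc_of_point.
  by exists x; split; [exact: disc_refl | rewrite /trace /= -pE].
apply: closed_bigcup; first exact: finite_finset.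
move=> i _; apply: closed_bigcup.
  by apply: sub_finite_set (nS i).1 => D [].
move=> D [dD _]; apply: (compact_closed hausM); apply: continuous_compact.
  exact/continuous_subspaceT/pt_continuous.
exact/normal_disc_compact/(nS i).2.
Qed.

Section Saturated.
Variables (S K : set M).
Hypotheses (nS : normal_surface S) (sat : disc_saturated S K).

Lemma saturated_component (C : set M) : C `<=` S -> connected C ->
  C `&` K !=set0 -> C `<=` K.
Proof.
move=> CS; apply: connected_meets sat.1 _ _ CS.
  exact: disc_saturated_closed nS sat.
exact: disc_saturated_closed nS (disc_saturatedD sat).
Qed.

Lemma component_saturatedE p : K p -> connected_component K p = connected_component S p.
Proof.
move=> Kp; have Sp := sat.1 p Kp; apply/seteqP; split.
  apply: connected_component_max; first exact: connected_component_refl.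
    exact: subset_trans (@connected_component_sub _ _ _) sat.1.
  exact: component_connected.
apply: connected_component_max; first exact: connected_component_refl.
  apply: saturated_component; first exact: connected_component_sub.
    exact: component_connected.
  by exists p; split=> //; exact: connected_component_refl.
exact: component_connected.
Qed.

(** The discs of K are discs of S, because K neither cuts nor joins components of the
    traces of S. *)
Lemma discs_saturated i D : discs K i D <-> discs S i D /\ D `<=` trace K i.
Proof.
have compE x : trace K i x ->
    connected_component (trace K i) x = connected_component (trace S i) x.
  move=> Kx; have Sx : trace S i x by apply: sat.1.
  apply/seteqP; split.
    apply: connected_component_max; first exact: connected_component_refl.
      apply: subset_trans (@connected_component_sub _ _ _) _ => y.
      exact: sat.1.
    exact: component_connected.
  apply: connected_component_max; first exact: connected_component_refl.
    apply: (sat.2 i); first exact: disc_of_point.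
    by exists x; split=> //; exact: connected_component_refl.
  exact: component_connected.
split=> [[x Kx <-]|[dD DK]].
  rewrite compE //; split; first by apply: disc_of_point; apply: sat.1.
  by rewrite -compE //; exact: connected_component_sub.
have [x Sx DE] := dD; have Dx : D x by rewrite -DE; exact: connected_component_refl.
by exists x; [exact: DK | rewrite compE //; exact: DK].
Qed.

(** The complement of K in S is closed, so the charts of S can be shrunk to avoid it;
    there K and S agree. *)
Lemma saturated_normal : normal_surface K.
Proof.
have cK := disc_saturated_closed nS sat.
have cSK := disc_saturated_closed nS (disc_saturatedD sat).
have [[compS embS] nS'] := nS.
split; last first.
  move=> i; split.
    by apply: sub_finite_set (nS' i).1 => D /discs_saturated [].
  by move=> D /discs_saturated [dD _]; apply: (nS' i).2.
split; first exact: subclosed_compact cK compS sat.1.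
move=> p Kp; have [U [phi [psi [[oU cphi cpsi phiK [W oW UW]] Up US]]]] := embS p (sat.1 p Kp).
have phiU u : U u -> psi (phi u) = u by move=> Uu; apply: phiK; exact/mem_set.
set V := ~` (S `\` K); have oV : open V by apply: closed_openC.
exists (U `&` V), phi, psi; split; last 2 first.
- by split=> // -[].
- apply/seteqP; split=> [_ [u [[Uu Vu] Ku] <-]|_ [[u [Uu Vu] <-] pl]].
    split; first by exists u.
    have : (phi @` (U `&` S)) (phi u) by exists u => //; split=> //; exact: sat.1.
    by rewrite US => -[].
  have : (phi @` U `&` [set y : 'rV[R]_3 | y 0 ord0 = 0]) (phi u).
    by split=> //; exists u.
  rewrite -US => -[u' [Uu' Su'] uE].
  have uu : u' = u.
    by have := congr1 psi uE; rewrite !phiU.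
  exists u => //; split=> //; apply: contrapT => Ku; apply: Vu.
  by rewrite -uu; split=> //; rewrite uu.
have UVU : phi @` (U `&` V) `<=` phi @` U by move=> _ [u [Uu _] <-]; exists u.
split.
- exact: openI.
- by apply: continuous_subspaceW cphi => u [].
- exact: continuous_subspaceW UVU cpsi.
- by move=> u /set_mem [Uu _]; apply: phiU.
have : open (psi @^-1` V : set (subspace (phi @` U))).
  by move/continuousP: cpsi; apply.
move=> /open_subspaceP [W1 oW1 W1E].
exists (W `&` W1); first exact: openI.
have -> : phi @` (U `&` V) = W1 `&` phi @` U.
  rewrite W1E; apply/seteqP; split=> [_ [u [Uu Vu] <-]|y [Vu [u Uu uE]]].
    by split; [rewrite /preimage /= phiU | exists u].
  by exists u => //; split=> //; move: Vu; rewrite -uE /preimage /= phiU.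
by rewrite UW setIA; congr (_ `&` _); rewrite setIC.
Qed.
End Saturated.
End Pieces.

(** * Gluing and the standard matching equations *)

Section Gluing.
Variables (R : realType) (n : nat) (T : triangulation n).
Local Notation M := (realization R T).
Implicit Types (S K : set M) (i j : 'I_n) (x y z : tet R) (a b c f : 'I_4) (p : 'S_4).

Lemma perm_tet_subproof p x : col_perm p^-1%g (val x : 'rV[R]_4) \in @simplex R.
Proof.
apply/mem_set; split=> [a|]; first by rewrite mxE; apply: bary_ge0.
rewrite -(bary_sum x) (reindex_inj (@perm_inj _ p)).
by apply: eq_bigr => a _; rewrite mxE permK.
Qed.

(** The affine map that takes vertex a to vertex [p a]. *)
Definition perm_tet p x : tet R :=
  exist (fun v => v \in @simplex R) _ (perm_tet_subproof p x).

Lemma bary_perm p x a : bary (perm_tet p x) (p a) = bary x a.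
Proof. by rewrite /bary /= mxE permK. Qed.

Lemma perm_tetK p : cancel (perm_tet p) (perm_tet p^-1%g).
Proof.
move=> x; apply: bary_inj => a.
by rewrite -[a in LHS](permK p) bary_perm bary_perm.
Qed.

Lemma perm_tet_continuous p : continuous (perm_tet p).
Proof.
have cv : continuous (fun x : tet R => val (perm_tet p x) : 'rV[R]_4).
  move=> x B [P nP PB].
  have nb (e : 'I_4) : nbhs x (fun z : tet R => P 0 e (bary z (p^-1%g e))).
    apply: (@bary_continuous R (p^-1%g e) x (P 0 e)).
    by have := nP 0 e; rewrite /= mxE.
  have : nbhs x [set z : tet R | forall e, P 0 e (bary z (p^-1%g e))].
    exact: (@filter_forall _ _ (fun e z => P 0 e (bary z (p^-1%g e))) (nbhs x)) nb.
  apply: (@filterS _ (nbhs x)) => z zP; apply: PB => k l.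
  by rewrite ord1 /= mxE; exact: zP.
move=> x U [_ /= [[W oW <-] /= Wx WU]].
have : nbhs x [set z | W (val (perm_tet p z))].
  by apply: (cv x W); apply: open_nbhs_nbhs; split.
by apply: (@filterS _ (nbhs x)) => z Wz; apply: WU.
Qed.

Lemma carrier_perm p x a b : carrier x = [set a; b]%SET ->
  carrier (perm_tet p x) = [set p a; p b]%SET.
Proof.
move=> cx; apply/setP => c; rewrite -[c](permKV p) in_carrier bary_perm -in_carrier.
by rewrite cx !inE !(inj_eq perm_inj).
Qed.

Lemma carrier_perm1 p x a : carrier x = [set a]%SET ->
  carrier (perm_tet p x) = [set p a]%SET.
Proof.
move=> cx; apply/setP => c; rewrite -[c](permKV p) in_carrier bary_perm -in_carrier.
by rewrite cx !inE !(inj_eq perm_inj).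
Qed.

Lemma pt_eqP i j x y : pt T i x = pt T j y <->
  clos_refl_sym_trans _ (@glued R n T) (existT (fun=> tet R) i x) (existT (fun=> tet R) j y).
Proof.
by split=> [/eqmodP /asboolP //|xy]; apply/eqmodP/asboolP.
Qed.

Lemma glued_perm (u v : tets R n) : glued T u v -> exists f p,
  [/\ gluing T (projT1 u) f = Some (projT1 v, p), bary (projT2 u) f = 0 &
      projT2 v = perm_tet p (projT2 u)].
Proof.
move=> [f [p [uf gl vE]]]; exists f, p; split=> //.
by apply: bary_inj => a; rewrite -[a](permKV p) vE bary_perm.
Qed.

Lemma glued_sym (u v : tets R n) : glued T u v -> glued T v u.
Proof.
move=> [f [p [uf gl vE]]]; exists (p f), p^-1%g; split; first by rewrite vE.
  exact: gluing_sym gl.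
by move=> a; rewrite -[a in RHS](permKV p) vE.
Qed.

Lemma pt_perm i f j p x : gluing T i f = Some (j, p) -> bary x f = 0 ->
  pt T i x = pt T j (perm_tet p x).
Proof.
move=> gl xf; apply/pt_eqP/rst_step; exists f, p; split=> // a.
exact: bary_perm.
Qed.

(** Edge points are counted instead of arcs, because their number is visibly the same
    in all tetrahedra around the edge. *)
Definition edge_points S i a b : set (tet R) :=
  [set x | trace S i x /\ carrier x = [set a; b]%SET].

Lemma edge_points_perm S i f j p a b x : gluing T i f = Some (j, p) ->
  a != f -> b != f -> edge_points S i a b x -> edge_points S j (p a) (p b) (perm_tet p x).
Proof.
move=> gl af bf [Sx cx]; split; last exact: carrier_perm.
rewrite /trace /= -(pt_perm gl) //.
by apply: (carrier_eq0 cx); rewrite !inE negb_or ![f == _]eq_sym af.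
Qed.

Lemma edge_points_glue S i f j p a b : gluing T i f = Some (j, p) ->
  a != f -> b != f ->
  edge_points S j (p a) (p b) = perm_tet p @` edge_points S i a b.
Proof.
move=> gl af bf; apply/seteqP; split=> [y Ey|_ [x Ex <-]]; last first.
  exact: (edge_points_perm gl af bf Ex).
exists (perm_tet p^-1%g y); last by have := perm_tetK p^-1%g y; rewrite invgK.
have := edge_points_perm (gluing_sym gl) _ _ Ey.
by rewrite !(inj_eq perm_inj) !permK; apply.
Qed.

Lemma cuts_off_uniq (D : set (tet R)) (t t' : tri_or_quad) :
  cuts_off D (side t) -> cuts_off D (side t') -> t = t'.
Proof.
move=> c c'; apply: side_inj => a b ab; apply/idP/idP => sab.
  exact: (c' a b ab).1 ((c a b ab).2 sab).
exact: (c a b ab).1 ((c' a b ab).2 sab).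
Qed.

Lemma edge_points_inj S i a b x y : normal_surface S -> a != b ->
  edge_points S i a b x -> edge_points S i a b y ->
  connected_component (trace S i) x y -> x = y.
Proof.
move=> nS ab [Sx cx] [Sy cy] xy.
have nD := (nS.2 i).2 _ (disc_of_point Sx).
apply: (normal_disc_edge_uniq nD) => //; last by rewrite cx cy.
  exact: connected_component_refl.
by rewrite cx cards2 ab.
Qed.

(** Each edge point lies on one disc, whose type separates a from b, and conversely a
    disc of such a type meets the edge in exactly one point. *)
Lemma card_edge_points S i a b : normal_surface S -> a != b ->
  finite_set (edge_points S i a b) /\
  #|` fset_set (edge_points S i a b)|%fset =
  (\sum_(t : tri_or_quad | separates (side t) a b) count_discs S i (side t))%N.
Proof.
move=> nS ab; have [fD nD] := nS.2 i.
set E := edge_points S i a b; pose cc := connected_component (trace S i).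
have ccI : {in E &, injective cc}.
  move=> x y /set_mem Ex /set_mem Ey xy; apply: (edge_points_inj nS ab Ex Ey).
  by rewrite -/(cc x) xy; apply: connected_component_refl; case: Ey.
pose meets := [set D | discs S i D /\ exists2 z, D z & carrier z = [set a; b]%SET].
have ccE : cc @` E = meets.
  apply/seteqP; split=> [_ [x [Sx cx] <-]|D [dD [z Dz cz]]].
    split; first exact: disc_of_point.
    by exists x => //; exact: connected_component_refl.
  exists z; first by split=> //; apply: (disc_sub dD).
  by rewrite (discE dD Dz).
have fmeets : finite_set meets by apply: sub_finite_set fD => D [].
have fE : finite_set E.
  by rewrite -(eq_finite_set (inj_card_eq ccI)) ccE.
split=> //.
pose DD := enum_fset (fset_set (discs S i)).
have DDP D : D \in DD <-> discs S i D.
  by rewrite in_fset_set //; split=> [/set_mem|/mem_set].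
have card_filter (P : set (set (tet R))) :
    #|` fset_set [set D | discs S i D /\ P D]|%fset = count (fun D => `[< P D >]) DD.
  rewrite -size_filter; apply/perm_size/uniq_perm.
  - exact: fset_uniq.
  - by rewrite filter_uniq // fset_uniq.
  move=> D; rewrite mem_filter in_fset_set; last by apply: sub_finite_set fD => ? [].
  apply/idP/idP => [/set_mem [dD PD]|/andP[/asboolP PD /DDP dD]]; last exact/mem_set.
  by apply/andP; split; [exact/asboolP | exact/DDP].
(* The default value is never reached on a normal disc. *)
pose ty (D : set (tet R)) : tri_or_quad :=
  odflt (inl ord0) [pick t | `[< cuts_off D (side t) >]].
have tyP D : D \in DD -> forall t, `[< cuts_off D (side t) >] = (ty D == t).
  move=> /DDP /nD /normal_disc_type [t0 Dt0] t.
  have -> : ty D = t0.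
    rewrite /ty; case: pickP => [t1 /asboolP Dt1|/(_ t0)] /=.
      exact: cuts_off_uniq Dt1 Dt0.
    by move/asboolP.
  apply/asboolP/eqP => [Dt|<- //]; exact: cuts_off_uniq Dt0 Dt.
have <- : #|` fset_set meets|%fset = #|` fset_set E|%fset.
  rewrite -ccE fset_set_image // card_in_imfset //= => x y.
  by rewrite !in_fset_set //; apply: ccI.
rewrite card_filter -sum1_count big_seq_cond.
rewrite (partition_big ty (fun t => separates (side t) a b)) /=; last first.
  move=> D /andP[DDD /asboolP Dab].
  by apply/(_ : cuts_off D (side (ty D))) => //; apply/asboolP; rewrite tyP.
apply: eq_bigr => t tab; rewrite /count_discs card_filter -sum1_count.
rewrite [RHS]big_seq_cond; apply: eq_bigl => D.
have [DDD|//] := boolP (D \in DD); rewrite /= (tyP _ DDD) /=.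
have [tE|_] := eqVneq (ty D) t; last by rewrite andbF.
rewrite andbT; apply/asboolP.
have : cuts_off D (side t) by apply/asboolP; rewrite tyP // tE.
by move/(_ a b ab) => ->.
Qed.

(** An arc around a in the face abc meets ab and ac but not bc, and an arc around b or c
    meets bc and one of ab and ac; so twice the number of arcs around a is a
    combination of the numbers of points on the three edges. *)
Lemma arc_countE (v : 'M[R]_(n, 4 + 3)) i (m : tri_or_quad -> R) :
  (forall a, lsubmx v i a = m (inl a)) -> (forall k, rsubmx v i k = m (inr k)) ->
  forall f a b c, uniq [:: f; a; b; c] ->
  (arc_count v i f a) *+ 2 = \sum_(t | separates (side t) a b) m t
    + \sum_(t | separates (side t) a c) m t - \sum_(t | separates (side t) b c) m t.
Proof.
move=> lE rE f a b c u.
pose arc (t : tri_or_quad) := match t with inl e => e == a | inr k => same_side k f a end.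
have -> : arc_count v i f a = \sum_(t | arc t) m t.
  rewrite big_sumType /= big_pred1_eq; congr (_ + _); first exact: lE.
  by apply: eq_bigr => k _; exact: rE.
rewrite -sumrMnl big_mkcond.
rewrite [X in _ = X + _ - _]big_mkcond [X in _ = _ + X - _]big_mkcond.
rewrite [X in _ = _ - X]big_mkcond -big_split -sumrB /=.
apply: eq_bigr => t _.
have key : if arc t then
    [&& separates (side t) a b, separates (side t) a c & ~~ separates (side t) b c]
  else (separates (side t) b c == (separates (side t) a b || separates (side t) a c))
     && ~~ (separates (side t) a b && separates (side t) a c).
  case: t => [e|k]; rewrite /separates /=.
    have N := uniq4_neq u; rewrite !inE.
    by have := uniq4_cover e u; rewrite !inE => /or4P[] /eqP ->; rewrite ?eqxx ?N.
  have : \sum_(e : 'I_4) (e \in quad_side k : nat) = 2%N.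
    (* Of the four vertices, two are on either side of a quadrilateral. *)
    transitivity #|quad_side k|; last by rewrite cards2 neq_lift.
    rewrite -sum1_card [RHS]big_mkcond; apply: eq_bigr => e _.
    by case: (e \in _).
  rewrite (uniq4_sum _ u) /same_side.
  by case: (f \in _); case: (a \in _); case: (b \in _); case: (c \in _).
case: (arc t) key => [/and3P[-> -> /negbTE ->]|/andP[/eqP ->]]; first by rewrite subr0 mulr2n.
by case: (separates _ a b); case: (separates _ a c) => //= _;
  rewrite ?oppr0 ?addr0 ?add0r ?subrr.
Qed.

Lemma normal_std_matching S : normal_surface S -> std_matching T (std_vector S).
Proof.
move=> nS i f j p a gl af.
have [b ub] : exists b, uniq [:: f; a; b].
  by apply: (@uniq_extend [:: _; _]) => //; rewrite /= inE eq_sym af.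
have [c u] := @uniq_extend [:: f; a; b] ub isT; rewrite /= in u.
have up : uniq [:: p f; p a; p b; p c].
  by rewrite -[[:: _; _; _; _]]/(map p [:: f; a; b; c]) (map_inj_uniq perm_inj).
pose m k (t : tri_or_quad) : R := (count_discs S k (side t))%:R.
have Em k := @arc_countE (std_vector S) k (m k).
have lE k d : lsubmx (std_vector S) k d = m k (inl d).
  by rewrite row_mxKl mxE.
have rE k d : rsubmx (std_vector S) k d = m k (inr d).
  by rewrite row_mxKr mxE.
have N := uniq4_neq u.
have bf : b != f by rewrite N.
have cf : c != f by rewrite N.
have sumE d e : d != e -> d != f -> e != f ->
   \sum_(t | separates (side t) d e) m i t =
   \sum_(t | separates (side t) (p d) (p e)) m j t.
  move=> de df ef; rewrite -!natr_sum.
  have pde : p d != p e by rewrite (inj_eq perm_inj).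
  have [fE <-] := card_edge_points i nS de.
  have [_ <-] := card_edge_points j nS pde.
  rewrite (edge_points_glue S gl) // fset_set_image // card_imfset //=.
  exact: can_inj (perm_tetK p).
apply/eqP; rewrite -(eqr_pMn2r (isT : (0 < 2)%N)); apply/eqP.
rewrite (Em i _ _ f a b c u) // (Em j _ _ (p f) (p a) (p b) (p c) up) //.
by rewrite !sumE ?N.
Qed.
End Gluing.

(** * Vertex linking components *)

Lemma finite_argmax (R : realType) (X : choiceType) (E : set X) (g : X -> R) :
  finite_set E -> E !=set0 -> exists2 x, E x & forall y, E y -> g y <= g x.
Proof.
move=> fE [x0 Ex0]; pose s := enum_fset (fset_set E).
have sP x : x \in s <-> E x by rewrite in_fset_set //; split=> [/set_mem|/mem_set].
suff [x xs xmax] : exists2 x, x \in s & forall y, y \in s -> g y <= g x.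
  by exists x; [exact/sP | move=> y /sP; exact: xmax].
have : s != [::] by apply/eqP => s0; move/sP: Ex0; rewrite s0.
elim: s {sP} => // y s IH _.
have [->|/IH [x xs xmax]] := eqVneq s [::].
  by exists y => [|z]; rewrite inE // => /eqP ->.
have [xy|yx] := leP (g x) (g y).
  exists y => [|z]; rewrite inE ?eqxx // => /predU1P[-> //|/xmax zx].
  exact: le_trans zx xy.
exists x => [|z]; rewrite inE ?xs ?orbT // => /predU1P[->|/xmax //].
exact: ltW.
Qed.

Section Link.
Variables (R : realType) (n : nat) (T : triangulation n).
Local Notation M := (realization R T).
Variable K : set M.
Hypotheses (hausM : hausdorff_space M) (nK : normal_surface K).
Implicit Types (i j : 'I_n) (x y z : tet R) (a b c f : 'I_4) (p : 'S_4)
  (D : set (tet R)).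

Let nD i D (dD : discs K i D) : normal_disc D := (nK.2 i).2 D dD.

(** The nearest point to a has the largest barycentric coordinate at a. *)
Definition nearest i a b x := edge_points K i a b x /\
  forall y, edge_points K i a b y -> bary y a <= bary x a.

Lemma edge_bary_inj a b x y : a != b -> carrier x = [set a; b]%SET ->
  carrier y = [set a; b]%SET -> bary x a = bary y a -> x = y.
Proof.
move=> ab cx cy xya; have [c uc] : exists c, uniq [:: a; b; c].
  by apply: (@uniq_extend [:: _; _]) => //; rewrite /= inE ab.
have [f u] := @uniq_extend [:: a; b; c] uc isT; rewrite /= in u.
have N := uniq4_neq u.
have z e : e \notin [set a; b]%SET -> bary x e = bary y e.
  by move=> e0; rewrite (carrier_eq0 cx) // (carrier_eq0 cy).
have xyc : bary x c = bary y c by apply: z; rewrite !inE !N.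
have xyf : bary x f = bary y f by apply: z; rewrite !inE !N.
have := bary_sum x; have := bary_sum y; rewrite !(uniq4_sum _ u) xya xyc xyf => Sy Sx.
apply: bary_inj => e; have := uniq4_cover e u; rewrite !inE => /or4P[] /eqP -> //.
by lra.
Qed.

Lemma nearest_uniq i a b x y : a != b -> nearest i a b x -> nearest i a b y -> x = y.
Proof.
move=> ab [Ex mx] [Ey my]; apply: (edge_bary_inj ab Ex.2 Ey.2).
by apply/eqP; rewrite eq_le mx // my.
Qed.

Lemma disc_third_edge D a b c x : normal_disc D -> uniq [:: a; b; c] ->
  D x -> carrier x = [set a; b]%SET ->
  (exists2 z, D z & carrier z = [set a; c]%SET) \/
  (exists2 z, D z & carrier z = [set b; c]%SET).
Proof.
move=> nD0; rewrite /= !inE negb_or => /and3P[/andP[ab ac] bc _] Dx cx.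
have [t Dt] := normal_disc_type nD0.
have sab : (a \in side t) != (b \in side t) by apply/(Dt a b ab); exists x.
have [sac|sac] := boolP ((a \in side t) != (c \in side t)).
  by left; apply/(Dt a c ac).
right; apply/(Dt b c bc); move: sab sac.
by case: (a \in _); case: (b \in _); case: (c \in _).
Qed.

Lemma discs_do_not_cross i D D' f a b c x y x' y' :
  discs K i D -> discs K i D' -> D <> D' -> uniq [:: f; a; b; c] ->
  D x -> D y -> D' x' -> D' y' ->
  carrier x = [set a; b]%SET -> carrier y = [set a; c]%SET ->
  carrier x' = [set a; c]%SET -> bary y a < bary x' a ->
  (carrier y' = [set a; b]%SET /\ bary y' a < bary x a) \/
    carrier y' = [set b; c]%SET -> False.
Proof.
move=> dD dD' DD' u Dx Dy Dx' Dy' cx cy cx' yx' cy'.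
have N := uniq4_neq u.
have [A AD arcA] : exists2 A, A `<=` D & arc_across f x y A.
  apply: (normal_disc_arc (nD dD)); rewrite ?cx ?cy ?cards2 ?inE ?N //.
  by rewrite set2_eq ?N // !eqxx.
have [B BD arcB] : exists2 B, B `<=` D' & arc_across f x' y' B.
  case: cy' => [[cy' _]|cy']; apply: (normal_disc_arc (nD dD'));
    rewrite ?cx' ?cy' ?cards2 ?inE ?N //.
    by rewrite set2_eq ?N // !eqxx.
  by rewrite set2_eq ?N // !eqxx.
have [z [/AD Dz /BD Dz']] := arcs_cross u arcA arcB cx cy cx' yx' cy'.
by apply: DD'; rewrite (discE dD Dz) (discE dD' Dz').
Qed.

(** Let D and D' be the discs through x and y, and suppose that they differ. If D met ac,
    it would do so farther from a than y, and the arc of D around a would be interlaced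
    with the arc of D' from y, which ends on ab beyond x or on bc. So the arc of D from
    x ends on bc, and is interlaced with the arc of D0 around a. *)
Lemma nearest_same_disc i f a b c D0 x y : uniq [:: f; a; b; c] ->
  discs K i D0 -> cuts_off D0 [set a]%SET -> nearest i a b x -> nearest i a c y ->
  connected_component (trace K i) x y.
Proof.
move=> u dD0 cut0 nx ny; apply: contrapT => nxy.
have N := uniq4_neq u; have [[Kx cx] mx] := nx; have [[Ky cy] my] := ny.
have ab : a != b by rewrite N. have ac : a != c by rewrite N.
set D := connected_component _ x in nxy; have dD : discs K i D := disc_of_point Kx.
have Dx : D x by apply: connected_component_refl.
pose D' := connected_component (trace K i) y.
have dD' : discs K i D' := disc_of_point Ky.
have D'y : D' y by apply: connected_component_refl.
have DD' : D <> D' by move=> DE; apply: nxy; rewrite DE.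
have sub D1 z : discs K i D1 -> D1 z -> trace K i z by move=> d1; apply: (disc_sub d1).
have noDac q : D q -> carrier q = [set a; c]%SET -> False.
  move=> Dq cq; have qy : bary q a < bary y a.
    rewrite lt_neqAle my ?andbT; last by split=> //; exact: sub Dq.
    by apply/eqP => /(edge_bary_inj ac cq cy) qy; apply: nxy; rewrite -qy.
  have uacb : uniq [:: a; c; b] by rewrite /= !inE !N.
  have cr y' := @discs_do_not_cross i D D' f a b c x q y y' dD dD' DD' u Dx Dq D'y.
  have [[y' Dy' cy']|[y' Dy' cy']] := disc_third_edge (nD dD') uacb D'y cy.
    apply: (cr y') => //; left; split=> //.
    rewrite lt_neqAle mx ?andbT; last by split=> //; exact: sub Dy'.
    apply/eqP => /(edge_bary_inj ab cy' cx) y'x; apply: DD'.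
    by rewrite (discE dD' Dy') y'x.
  by apply: (cr y') => //; right; rewrite cy' finset.setUC.
have uabc : uniq [:: a; b; c] by rewrite /= !inE !N.
have [[q Dq /(noDac q Dq)//]|[r Dr cr]] := disc_third_edge (nD dD) uabc Dx cx.
have [p0 D0p cp] : exists2 z, D0 z & carrier z = [set a; b]%SET.
  by apply/(cut0 a b ab); rewrite !inE !N eqxx.
have [q D0q cq] : exists2 z, D0 z & carrier z = [set a; c]%SET.
  by apply/(cut0 a c ac); rewrite !inE !N eqxx.
have [D0D|D0D] := pselect (D0 = D); first by apply: (noDac q); rewrite -?D0D.
have uf : uniq [:: f; a; c; b] by rewrite /= !inE !N.
apply: (discs_do_not_cross dD0 dD D0D uf D0q D0p Dx Dr cq cp cx).
  rewrite lt_neqAle mx ?andbT; last by split=> //; exact: sub D0p.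
  apply/eqP => /(edge_bary_inj ab cp cx) p0x; apply: D0D.
  by rewrite (discE dD0 D0p) p0x.
by right; rewrite cr finset.setUC.
Qed.

(** Nearness is expressed on the edges at a, where points are linearly ordered. *)
Definition near_disc i a D := discs K i D /\
  forall b, b != a -> exists2 x, D x & nearest i a b x.

Lemma near_disc_exists i a D0 : discs K i D0 -> cuts_off D0 [set a]%SET ->
  exists D, near_disc i a D.
Proof.
move=> dD0 cut0.
have ex b : b != a -> exists x, nearest i a b x.
  rewrite eq_sym => ab; have [fE _] := card_edge_points i nK ab.
  have [|x Ex mx] := @finite_argmax R _ _ (fun x => bary x a) fE; last by exists x.
  have [z Dz cz] : exists2 z, D0 z & carrier z = [set a; b]%SET.
    by apply/(cut0 a b ab); rewrite !inE eqxx [b == a]eq_sym (negbTE ab).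
  by exists z; split=> //; apply: (disc_sub dD0).
have [b0] := @uniq_extend [:: a] isT isT; rewrite /= inE andbT => ab0.
have [x nx] : exists x, nearest i a b0 x by apply: ex; rewrite eq_sym.
have Kx := nx.1.1.
exists (connected_component (trace K i) x); split; first exact: disc_of_point.
move=> b ba; have [->|bb0] := eqVneq b b0.
  by exists x => //; exact: connected_component_refl.
have [y ny] := ex b ba; exists y => //.
have [f] : exists f, uniq (rcons [:: a; b0; b] f).
  by apply: uniq_extend; rewrite //= !inE negb_or ab0 eq_sym ba eq_sym bb0.
rewrite -rot1_cons rot_uniq => u; exact: (nearest_same_disc u dD0 cut0 nx ny).
Qed.

Lemma near_disc_uniq i a D D' : near_disc i a D -> near_disc i a D' -> D = D'.
Proof.
move=> [dD nearD] [dD' nearD'].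
have [b] := @uniq_extend [:: a] isT isT; rewrite /= inE andbT => ab.
have ba : b != a by rewrite eq_sym.
have [x Dx nx] := nearD b ba; have [x' Dx' nx'] := nearD' b ba.
by rewrite (discE dD Dx) (discE dD' Dx') (nearest_uniq ab nx nx').
Qed.

(** No other type crosses all three edges at a. *)
Lemma near_disc_type i a D : near_disc i a D -> cuts_off D [set a]%SET.
Proof.
move=> [dD nearD]; have [t Dt] := normal_disc_type (nD dD).
have sep b : b != a -> separates (side t) a b.
  move=> ba; have [x Dx [[_ cx] _]] := nearD b ba.
  by apply: (Dt a b _).1; [rewrite eq_sym | exists x].
suff <- : side t = [set a]%SET by [].
suff -> : t = inl a by [].
apply: side_inj => c d cd; rewrite /separates /= !inE.
have [cE|ca] := eqVneq c a; have [dE|da] := eqVneq d a.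
- by move: cd; rewrite cE dE eqxx.
- by rewrite cE; apply: sep.
- by rewrite dE eq_sym; apply: sep.
- by have := sep c ca; have := sep d da; rewrite /separates;
    case: (a \in _); case: (c \in _); case: (d \in _).
Qed.

(** The disc, being of triangle type around a, misses the face opposite a; in every
    other face f it has one arc, which joins x to a nearest point inside the disc. *)
Lemma near_disc_face i a D f x : near_disc i a D -> D x -> bary x f = 0 ->
  f != a /\ exists b x0 (A : set (tet R)),
    [/\ b != a, b != f, nearest i a b x0, forall z, A z -> bary z f = 0 &
        [/\ connected A, A `<=` D, A x & A x0]].
Proof.
move=> nearD Dx xf; have [dD near] := nearD.
have cut := near_disc_type nearD.
have [x0 [y0 [A [AD Ax arcA]]]] := normal_disc_face (nD dD) Dx xf.
have [[x0f _ cx0 _ _] _ [g [[gc _] g0 _ AE]]] := arcA.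
have Ax0 : A x0.
  by rewrite AE; exists 0 => //=; rewrite in_itv /= lexx ler01.
have Ac : connected A.
  rewrite AE; apply: connected_continuous_connected gc.
  by apply/connected_intervalP; exact: interval_is_interval.
have [c [d [cd cE]]] : exists c d, c != d /\ carrier x0 = [set c; d]%SET.
  by move/eqP/cards2P: cx0 => [c [d [? ?]]]; exists c, d.
have [b ba cxb] : exists2 b, b != a & carrier x0 = [set a; b]%SET.
  have : (c \in [set a]%SET) != (d \in [set a]%SET).
    by apply/(cut c d cd); exists x0 => //; apply: AD.
  rewrite !inE; have [ca|ca] := eqVneq c a; have [da|da] := eqVneq d a => // _.
    by exists d; rewrite // cE ca.
  by exists c; rewrite // cE da finset.setUC.
have : f \notin carrier x0 by rewrite in_carrier x0f eqxx.
rewrite cxb !inE negb_or => /andP[fa fb]; split=> //.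
exists b, x0, A; split=> //; [by rewrite eq_sym | | by move=> z; apply: arc_across_face arcA].
have [x1 Dx1 nx1] := near b ba.
suff <- : x1 = x0 by [].
apply: (normal_disc_edge_uniq (nD dD)) => //; first exact: AD.
  by rewrite nx1.1.2 cards2 eq_sym ba.
by rewrite nx1.1.2 cxb.
Qed.

Lemma nearest_glue i f j p a b x : gluing T i f = Some (j, p) -> a != f -> b != f ->
  nearest i a b x -> nearest j (p a) (p b) (perm_tet p x).
Proof.
move=> gl af bf [Ex mx]; split; first exact: (edge_points_perm gl af bf Ex).
move=> y; rewrite (edge_points_glue K gl af bf) => -[z Ez <-].
by rewrite !bary_perm; apply: mx.
Qed.

(** Gluing takes the arc of D in the face f to a connected part of K that contains a
    nearest point at the corner [p a]; so this part lies on D'. *)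
Lemma near_disc_glue i f j p a D D' x : gluing T i f = Some (j, p) ->
  near_disc i a D -> near_disc j (p a) D' -> D x -> bary x f = 0 ->
  D' (perm_tet p x).
Proof.
move=> gl nearD nearD' Dx xf.
have [fa [b [x0 [A [ba bf nx0 Af [Ac AD Ax Ax0]]]]]] := near_disc_face nearD Dx xf.
have ab : a != b by rewrite eq_sym.
have af : a != f by rewrite eq_sym.
have pba : p b != p a by rewrite (inj_eq perm_inj).
have [dD' near'] := nearD'; have [y0 D'y0 ny0] := near' (p b) pba.
have y0E : y0 = perm_tet p x0.
  by apply: (nearest_uniq _ ny0); [rewrite eq_sym | exact: (nearest_glue gl)].
have xA z : A z -> trace K j (perm_tet p z).
  move=> Az; rewrite /trace /= -(pt_perm gl) ?Af //.
  exact: (disc_sub nearD.1 (AD z Az)).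
rewrite (discE dD' D'y0); exists (perm_tet p @` A); last by exists x.
split; first by exists x0.
  by move=> _ [z Az <-]; exact: xA.
apply: connected_continuous_connected => //.
exact/continuous_subspaceT/perm_tet_continuous.
Qed.

Section VertexLink.
Variable V : M.
Hypothesis corner_triangle : forall i a, is_corner V i a ->
  exists2 D, discs K i D & cuts_off D [set a]%SET.

Let corner_disc i a : is_corner V i a -> exists D, near_disc i a D.
Proof. by move=> /corner_triangle [D dD cut]; exact: near_disc_exists dD cut. Qed.

Definition nearest_link : set M :=
  [set q | exists i a D x, [/\ is_corner V i a, near_disc i a D, D x & q = pt T i x]].

Let corner_glue i f j p a : gluing T i f = Some (j, p) -> a != f ->
  is_corner V i a -> is_corner V j (p a).
Proof.
move=> gl af [x cx xV]; exists (perm_tet p x); first exact: carrier_perm1.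
by rewrite -(pt_perm gl) // (carrier_eq0 cx) // inE eq_sym.
Qed.

Let in_near (u : tets R n) := exists a D,
  [/\ is_corner V (projT1 u) a, near_disc (projT1 u) a D & D (projT2 u)].

Let in_near_glued (u v : tets R n) : clos_refl_sym_trans _ (@glued R n T) u v ->
  in_near u <-> in_near v.
Proof.
have step u' v' : glued T u' v' -> in_near u' -> in_near v'.
  move=> /glued_perm [f [p [gl uf vE]]] [a [D [Va nearD Du]]].
  have [fa _] := near_disc_face nearD Du uf.
  have Vpa : is_corner V (projT1 v') (p a) by apply: (corner_glue gl) => //; rewrite eq_sym.
  have [D' nearD'] := corner_disc Vpa.
  by exists (p a), D'; split=> //; rewrite vE; exact: (near_disc_glue gl nearD nearD').
elim=> {u v} [u v uv|u|u v _ -> //|u v w _ uv _ vw]; last 2 first.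
- by [].
- by rewrite uv.
by split; apply: step => //; exact: glued_sym.
Qed.

(** A point of a nearest disc may be identified with points of other tetrahedra, but
    along each identification it stays in a nearest disc ([in_near_glued]). *)
Lemma trace_link i x : trace nearest_link i x <->
  exists a D, [/\ is_corner V i a, near_disc i a D & D x].
Proof.
split=> [[j [a [D [y [Va nearD Dy yx]]]]]|[a [D [Va nearD Dx]]]]; last first.
  by exists i, a, D, x.
have /pt_eqP/in_near_glued E := yx.
by apply/E; exists a, D.
Qed.

Lemma link_saturated : disc_saturated K nearest_link.
Proof.
split=> [_ [i [a [D [x [_ [dD _] Dx ->]]]]]|
  i D dD [x [Dx /trace_link [a [D' [Va nearD D'x]]]]] y Dy].
  exact: (disc_sub dD Dx).
apply/trace_link; exists a, D'; split=> //.
by rewrite (discE nearD.1 D'x) -(discE dD Dx).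
Qed.

Lemma discs_link i D : discs nearest_link i D <-> exists2 a, is_corner V i a & near_disc i a D.
Proof.
split=> [/(discs_saturated link_saturated) [dD DL]|[a Va nearD]].
  have [x Kx DE] := dD.
  have Dx : D x by rewrite -DE; exact: connected_component_refl.
  have /trace_link [a [D' [Va nearD D'x]]] := DL x Dx; exists a => //.
  by rewrite (discE dD Dx) -(discE nearD.1 D'x).
apply/(discs_saturated link_saturated); split; first exact: nearD.1.
by move=> x Dx; apply/trace_link; exists a, D.
Qed.

Lemma std_vector_link : std_vector nearest_link = link_vector V.
Proof.
have count0 i (X : {set 'I_4}) (t : tri_or_quad) : side t = X ->
    (forall a, is_corner V i a -> t <> inl a) -> count_discs nearest_link i X = 0%N.
  move=> tX no; rewrite /count_discs (_ : [set D | _] = set0) ?fset_set0 ?cardfs0 //.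
  apply/seteqP; split=> // D [/discs_link [a Va nearD] cut]; apply: (no a Va).
  by apply: (cuts_off_uniq (D := D)); rewrite ?tX //; exact: near_disc_type nearD.
congr row_mx; apply/matrixP => i k; rewrite !mxE; last by rewrite (@count0 i _ (inr k)).
have [Va|nVa] := pselect (is_corner V i k); last first.
  rewrite (@count0 i _ (inl k)) //; last by move=> a Va [ka]; apply: nVa; rewrite ka.
  by rewrite (_ : `[< _ >] = false) //; apply/asboolP.
rewrite (_ : `[< _ >] = true); last exact/asboolP.
have [D nearD] := corner_disc Va.
rewrite /count_discs (_ : [set D | _] = [set D]) ?fset_set1 ?cardfs1 //.
apply/seteqP; split=> [D' [/discs_link [a Va' nearD'] cut]|_ ->].
  have [ka] : inl k = inl a :> tri_or_quad.
    by apply: (cuts_off_uniq (D := D')) => //; exact: near_disc_type nearD'.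
  by rewrite -ka in nearD'; exact: near_disc_uniq nearD' nearD.
by split; [apply/discs_link; exists k | exact: near_disc_type nearD].
Qed.

(* For u a vertex of a tetrahedron, the component of the nearest disc at u. *)
Let joined (u : tets R n) : set M := [set q | exists a D x,
  [/\ carrier (projT2 u) = [set a]%SET, near_disc (projT1 u) a D, D x &
      connected_component nearest_link (pt T (projT1 u) x) q]].

Let joined_glued (u v : tets R n) : clos_refl_sym_trans _ (@glued R n T) u v ->
  pt T (projT1 u) (projT2 u) = V -> joined u = joined v.
Proof.
have step u' v' : glued T u' v' -> pt T (projT1 u') (projT2 u') = V ->
    joined u' `<=` joined v'.
  move=> /glued_perm [f [p [gl uf vE]]] uV q [a [D [x [cu nearD Dx xq]]]].
  have Va : is_corner V (projT1 u') a by exists (projT2 u').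
  have af : a != f.
    apply/eqP => af; move: uf => /eqP.
    by rewrite -af -[_ == 0]negbK -in_carrier cu inE eqxx.
  have [D' nearD'] := corner_disc (corner_glue gl af Va).
  have [b] : exists b, uniq [:: a; f; b].
    by apply: (@uniq_extend [:: _; _]) => //; rewrite /= inE af.
  rewrite /= !inE negb_or => /and3P[/andP[_ ab] fb _].
  have [|x0 Dx0 nx0] := nearD.2 b; first by rewrite eq_sym.
  have bf : b != f by rewrite eq_sym.
  have pab : p b != p a by rewrite (inj_eq perm_inj) eq_sym.
  have [y0 D'y0 ny0] := nearD'.2 (p b) pab.
  exists (p a), D', y0; split=> //; first by rewrite vE; exact: carrier_perm1.
  have y0E : y0 = perm_tet p x0.
    by apply: (nearest_uniq _ ny0); [rewrite eq_sym | exact: (nearest_glue gl)].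
  have x0f : bary x0 f = 0.
    by apply: (carrier_eq0 nx0.1.2); rewrite !inE negb_or ![f == _]eq_sym af.
  rewrite y0E -(pt_perm gl) //; apply: connected_component_trans xq.
  exists (pt T (projT1 u') @` D); last by exists x.
  split; first by exists x0.
    by move=> _ [z Dz <-]; apply/trace_link; exists a, D.
  exact/pt_connected/(disc_connected nearD.1).
have ptE u' v' : clos_refl_sym_trans _ (@glued R n T) u' v' ->
    pt T (projT1 u') (projT2 u') = pt T (projT1 v') (projT2 v').
  by move=> uv; apply/pt_eqP; rewrite -!sigT_eta.
elim=> {u v} [u v uv uV|u //|u v /ptE uv IH vV|u v w /ptE uv IH1 _ IH2 uV].
- apply/seteqP; split; apply: step => //; first exact: glued_sym.
  by rewrite -uV; apply/esym/ptE/rst_step.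
- by rewrite IH // uv.
- by rewrite IH1 // IH2 // -uv.
Qed.

(** Nearest discs at corners that are identified across a face share a nearest point
    ([joined_glued]), and all corners of V are related by such identifications. *)
Lemma link_connected : connected nearest_link.
Proof.
have [[q0 Lq0]|L0] := pselect (exists q0, nearest_link q0); last first.
  rewrite (_ : nearest_link = set0); first exact: connected0.
  by apply/seteqP; split=> // q Lq; apply: L0; exists q.
suff <- : connected_component nearest_link q0 = nearest_link by exact: component_connected.
apply/seteqP; split=> [|q Lq]; first exact: connected_component_sub.
case: Lq0 => i [a [D [x [[e ce eV] nearD Dx ->]]]].
case: Lq (Lq) => j [b [D' [y [[e' ce' e'V] nearD' D'y qE]]]] Lq.
have jE : joined (existT (fun=> tet R) i e) = joined (existT (fun=> tet R) j e').
  by apply: joined_glued => //; apply/pt_eqP; rewrite eV.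
have : joined (existT (fun=> tet R) j e') q.
  exists b, D', y; split=> //; rewrite -qE; exact: connected_component_refl.
rewrite -jE => -[a1 [D1 [x1 [/= ce1 nearD1 D1x1]]]].
have aE : a1 = a by apply/set1_inj; rewrite -ce1 -ce.
rewrite aE in nearD1; rewrite (near_disc_uniq nearD1 nearD) in D1x1.
apply: connected_component_trans.
exists (pt T i @` D); last by exists x1.
split; first by exists x.
  by move=> _ [z Dz <-]; apply/trace_link; exists a, D; split=> //; exists e.
exact/pt_connected/(disc_connected nearD.1).
Qed.
End VertexLink.

Lemma vertex_link_component (V : M) : (exists i a, is_corner V i a) ->
  (forall i a, is_corner V i a -> exists2 D, discs K i D & cuts_off D [set a]%SET) ->
  exists2 p, K p & vertex_linking (connected_component K p).
Proof.
move=> [i [a Va]] tri.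
have [D0 dD0 cut0] := tri i a Va.
have [D nearD] := near_disc_exists dD0 cut0.
have [x Kx DE] := nearD.1.
have Dx : D x by rewrite -DE; exact: connected_component_refl.
have sat := link_saturated tri; have Lc := link_connected tri.
exists (pt T i x); first exact: (disc_sub nearD.1 Dx).
have Lx : nearest_link V (pt T i x) by exists i, a, D, x.
rewrite -(component_saturatedE hausM nK sat Lx) connected_component_id //.
split; first exact: (saturated_normal hausM nK sat).
by exists V; split; [exists i, a | exact: std_vector_link].
Qed.
End Link.

(** * The canonical part *)

Section Canonical.
Variables (R : realType) (n : nat) (T : triangulation n).
Local Notation M := (realization R T).
Hypothesis hausM : hausdorff_space M.
Variable S : set M.
Hypothesis nS : normal_surface S.
Implicit Types (i : 'I_n) (a : 'I_4).

Lemma canonical_saturated : disc_saturated S (canonical_part S).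
Proof.
apply: component_saturated => [p []//|p q [Sp nvp] pq].
split; first exact: connected_component_sub pq.
by rewrite -(same_connected_component pq).
Qed.

Lemma canonical_normal : normal_surface (canonical_part S).
Proof. exact: (saturated_normal hausM nS canonical_saturated). Qed.

Lemma component_of_saturated p : disc_saturated S (connected_component S p).
Proof.
apply: component_saturated; first exact: connected_component_sub.
by move=> q q' pq; exact: connected_component_trans pq.
Qed.

Lemma count_discs_neq0 (K : set M) i (X : {set 'I_4}) : normal_surface K ->
  (count_discs K i X != 0)%N <-> exists2 D, discs K i D & cuts_off D X.
Proof.
move=> nK; have fK : finite_set [set D | discs K i D /\ cuts_off D X].
  by apply: sub_finite_set (nK.2 i).1 => D [].
rewrite /count_discs cardfs_eq0; split=> [/fset0Pn [D]|[D dD cD]].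
  by rewrite in_fset_set // => /set_mem [dD cD]; exists D.
by apply/fset0Pn; exists D; rewrite in_fset_set //; exact/mem_set.
Qed.

(** A quadrilateral lies in no vertex linking component. *)
Lemma quad_vector_canonical : quad_vector (canonical_part S) = quad_vector S.
Proof.
apply/matrixP => i k; rewrite !mxE /count_discs.
rewrite (_ : [set D | discs (canonical_part S) i D /\ _] =
  [set D | discs S i D /\ cuts_off D (quad_side k)]) //.
apply/seteqP; split=> D [dD cD]; split=> //.
  by have /(discs_saturated canonical_saturated) [] := dD.
apply/(discs_saturated canonical_saturated); split=> //.
have [x Sx DE] := dD; have Dx : D x by rewrite -DE; exact: connected_component_refl.
apply: (canonical_saturated.2 i) => //; exists x; split=> //; split=> // -[nC [V [_ CV]]].
have satC := component_of_saturated (pt T i x).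
have : quad_vector (connected_component S (pt T i x)) i k = 0.
  move/(congr1 rsubmx): CV; rewrite /link_vector !row_mxKr => ->; exact: mxE.
rewrite mxE => /eqP; rewrite pnatr_eq0; apply/negP/(count_discs_neq0 i _ nC).
exists D => //; apply/(discs_saturated satC); split=> //.
apply: (satC.2 i) => //; exists x; split=> //.
exact: connected_component_refl.
Qed.

(** Otherwise [vertex_link_component] finds a vertex linking component of the canonical
    part, which would be a component of S as well. *)
Lemma canonical_gap (V : M) : (exists i a, is_corner V i a) ->
  exists i a, is_corner V i a /\ count_discs (canonical_part S) i [set a]%SET = 0%N.
Proof.
move=> exV; apply: contrapT => no.
have [i a Va|p Kp vp] := vertex_link_component hausM canonical_normal exV.
  apply/(count_discs_neq0 _ _ canonical_normal)/eqP => c0; apply: no.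
  by exists i, a.
apply: (Kp.2); rewrite -(component_saturatedE hausM nS canonical_saturated) //.
Qed.
End Canonical.

(** * Solutions of the matching equations *)

Section Matchings.
Variables (R : realType) (n : nat) (T : triangulation n).
Local Notation M := (realization R T).
Implicit Types (x y v : 'M[R]_(n, 4 + 3)).

(** The sums of F over the elements of a cycle and of G over their successors agree
    term by term. *)
Lemma sum_cycle (V : nmodType) (X : eqType) (e : rel X) (F G : X -> V) c :
  (forall u u', e u u' -> F u = G u') -> path.cycle e c ->
  \sum_(u <- c) F u = \sum_(u <- c) G u.
Proof.
move=> FG; case: c => [|u p] /=; first by rewrite !big_nil.
have path_sum z s : path e z s -> \sum_(u <- belast z s) F u = \sum_(u <- s) G u.
  elim: s z => [|z' s IH] z /=; first by rewrite !big_nil.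
  by move=> /andP[zz' z's]; rewrite !big_cons (FG _ _ zz') IH.
move/path_sum; rewrite belast_rcons => ->.
by rewrite -cats1 big_cat /= big_seq1 big_cons addrC.
Qed.

Lemma same_sideC k a b : same_side k a b = same_side k b a.
Proof. exact: eq_sym. Qed.

(** Each step around the edge crosses a face, and the standard matching equation of that
    face at the lower end of the edge compares the triangle and quadrilateral
    coordinates of the two tetrahedra; in the sum around the cycle the triangle
    coordinates at the lower end cancel. *)
Lemma quad_of_std_matching x : std_matching T x -> quad_matching T (rsubmx x).
Proof.
move=> mx c /andP[cyc _].
pose t (u : 'I_n * 'S_4) := lsubmx x u.1 (u.2 0).
pose g (u : 'I_n * 'S_4) := \sum_(k | same_side k (u.2 0) (u.2 2)) rsubmx x u.1 k.
pose h (u : 'I_n * 'S_4) := \sum_(k | same_side k (u.2 0) (u.2 3)) rsubmx x u.1 k.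
have : \sum_(u <- c) (t u + h u) = \sum_(u <- c) (t u + g u).
  apply: sum_cycle cyc => -[i s] [j s']; rewrite /turn /=.
  case gl: (gluing T i (s 3)) => [[j' p]|//] /eqP [-> ->].
  have := mx _ _ _ _ (s 0) gl; rewrite (inj_eq perm_inj) => /(_ isT).
  rewrite /arc_count /t /g /h /= !permM tpermL tpermD // => E.
  under eq_bigl do rewrite same_sideC.
  rewrite E; congr (_ + _).
  by apply: eq_bigl => k; rewrite same_sideC.
by rewrite !big_split /= => /addrI.
Qed.

Lemma arc_countB x y (al : R) i f a :
  arc_count (x - al *: y) i f a = arc_count x i f a - al * arc_count y i f a.
Proof.
rewrite /arc_count mulrDr opprD addrACA mulr_sumr -sumrB; congr (_ + _).
  by rewrite !mxE.
by apply: eq_bigr => k _; rewrite !mxE.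
Qed.

Lemma std_matchingB x y (al : R) : std_matching T x -> std_matching T y ->
  std_matching T (x - al *: y).
Proof.
by move=> mx my i f j p a gl af; rewrite !arc_countB (mx _ _ _ _ _ gl) // (my _ _ _ _ _ gl).
Qed.

Lemma std_matchingZ (c : R) x : std_matching T x -> std_matching T (c *: x).
Proof.
move=> mx i f j p a gl af.
have arcZ k e b : arc_count (c *: x) k e b = c * arc_count x k e b.
  rewrite /arc_count mulrDr mulr_sumr; congr (_ + _); first by rewrite !mxE.
  by apply: eq_bigr => l _; rewrite !mxE.
by rewrite !arcZ (mx _ _ _ _ _ gl).
Qed.

Lemma quad_matchingZ (c : R) (q : 'M[R]_(n, 3)) : quad_matching T q ->
  quad_matching T (c *: q).
Proof.
move=> mq s /mq E.
have sumZ (P : 'I_n * 'S_4 -> pred 'I_3) :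
    \sum_(u <- s) \sum_(k | P u k) (c *: q) u.1 k =
    c * \sum_(u <- s) \sum_(k | P u k) q u.1 k.
  rewrite mulr_sumr; apply: eq_bigr => u _; rewrite mulr_sumr.
  by apply: eq_bigr => k _; rewrite mxE.
by rewrite !sumZ E.
Qed.

(** Without quadrilaterals, a matching equation says that the triangle coordinates of
    two identified corners agree. *)
Lemma corner_constant (d : 'M[R]_(n, 4 + 3)) (V : M) i a j b :
  std_matching T d -> rsubmx d = 0 -> is_corner V i a -> is_corner V j b ->
  lsubmx d i a = lsubmx d j b.
Proof.
move=> md d0 [x cx xV] [y cy yV].
pose Q (u : tets R n) := exists e, carrier (projT2 u) = [set e]%SET /\
   lsubmx d (projT1 u) e = lsubmx d i a.
have step (u w : tets R n) : glued T u w -> Q u -> Q w.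
  move=> /glued_perm [f [p [gl uf vE]]] [e [cu ue]]; exists (p e).
  rewrite vE; split; first exact: carrier_perm1.
  have ef : e != f.
    apply/eqP => ef; move: uf => /eqP; rewrite -ef -[_ == 0]negbK -in_carrier.
    by rewrite cu inE eqxx.
  rewrite -ue; have := md _ _ _ _ _ gl ef; rewrite /arc_count d0.
  by rewrite !big1 ?addr0 => [->|k _|k _]; rewrite ?mxE.
have steps (u w : tets R n) : clos_refl_sym_trans _ (@glued R n T) u w -> Q u <-> Q w.
  elim=> {u w} [u w uw|//|u w _ -> //|u w w' _ -> _ -> //].
  by split; apply: step => //; exact: glued_sym.
have /pt_eqP/steps [+ _] : pt T i x = pt T j y by rewrite xV.
case; first by exists a.
by move=> e [/= ce <-]; congr (lsubmx d j _); apply/set1_inj; rewrite -ce -cy.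
Qed.

Lemma mx_ge0_split (d : 'M[R]_(n, 4 + 3)) : (forall i a, 0 <= lsubmx d i a) ->
  (forall i k, 0 <= rsubmx d i k) -> forall i j, 0 <= d i j.
Proof.
move=> dl dr i j; rewrite -[d]hsubmxK mxE; case: (splitP j) => k _; [exact: dl | exact: dr].
Qed.

(** The difference is constant around each vertex, and at the corner where v vanishes
    it equals a coordinate of y. *)
Lemma dominated_by_gap v y (al : R) : std_matching T v -> std_matching T y ->
  (forall i j, 0 <= y i j) -> rsubmx y = al *: rsubmx v ->
  (forall V : M, (exists i a, is_corner V i a) ->
     exists i a, is_corner V i a /\ lsubmx v i a = 0) ->
  forall i j, 0 <= (y - al *: v) i j.
Proof.
move=> mv my y0 yv gap.
have d0 : rsubmx (y - al *: v) = 0.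
  by rewrite linearB linearZ /= yv subrr.
apply: mx_ge0_split => i a; last by rewrite d0 mxE.
have [x cx] : exists x : tet R, carrier x = [set a]%SET.
  have [||x xE] := @bary_tet R (fun b => (b == a)%:R).
  - by move=> b; rewrite ler0n.
  - by rewrite (bigD1 a) //= eqxx big1 ?addr0 // => b /negbTE ->.
  exists x; apply/setP => b; rewrite in_carrier xE inE pnatr_eq0.
  by case: (b == a).
have Va : is_corner (pt T i x) i a by exists x.
have [|i0 [a0 [Va0 v0]]] := gap (pt T i x); first by exists i, a.
rewrite (corner_constant (std_matchingB al my mv) d0 Va Va0).
move: v0; rewrite !mxE => ->; rewrite mulr0 subr0; exact: y0.
Qed.
End Matchings.

(** * Extreme rays *)

Section Polytopes.
Variables (R : realType) (m d : nat).
Implicit Types (x a b : 'M[R]_(m, d)).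

Lemma coord_sumZ (c : R) x : coord_sum (c *: x) = c * coord_sum x.
Proof.
rewrite /coord_sum mulr_sumr; apply: eq_bigr => i _; rewrite mulr_sumr.
by apply: eq_bigr => j _; rewrite mxE.
Qed.

Lemma coord_sumD a b : coord_sum (a + b) = coord_sum a + coord_sum b.
Proof.
rewrite /coord_sum -big_split; apply: eq_bigr => i _; rewrite -big_split.
by apply: eq_bigr => j _; rewrite mxE.
Qed.

Lemma coord_sum_ge0 x : (forall i j, 0 <= x i j) -> 0 <= coord_sum x.
Proof. by move=> x0; apply: sumr_ge0 => i _; apply: sumr_ge0. Qed.

Lemma coord_sum_eq0 x : (forall i j, 0 <= x i j) -> coord_sum x = 0 -> x = 0.
Proof.
move=> x0 /eqP; rewrite psumr_eq0 => [/allP s0|i _]; last by apply: sumr_ge0.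
apply/matrixP => i j; rewrite mxE; apply/eqP.
have := s0 i; rewrite mem_index_enum => /(_ isT) /=.
by rewrite psumr_eq0 // => /allP /(_ j); rewrite mem_index_enum => /(_ isT).
Qed.

(** If neither a nor b vanishes, their normalisations are feasible, and x is a proper
    convex combination of them. *)
Lemma extreme_ray (P : 'M[R]_(m, d) -> Prop) x a b (c : R) :
  (forall e y, P y -> P (e *: y)) -> polytope_vertex (solution_space P) x ->
  (forall i j, 0 <= a i j) -> (forall i j, 0 <= b i j) -> P a -> P b ->
  a + b = c *: x -> a = coord_sum a *: x.
Proof.
move=> PZ [[x0 x1 Px] ext] a0 b0 Pa Pb abx.
have sa := coord_sum_ge0 a0; have sb := coord_sum_ge0 b0.
have sab : coord_sum a + coord_sum b = c by rewrite -coord_sumD abx coord_sumZ x1 mulr1.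
have [a_0|an0] := eqVneq (coord_sum a) 0.
  by rewrite a_0 scale0r; apply: coord_sum_eq0.
have [b_0|bn0] := eqVneq (coord_sum b) 0.
  by rewrite -[LHS]addr0 -{1}(coord_sum_eq0 b0 b_0) abx -sab b_0 addr0.
have ap : 0 < coord_sum a by rewrite lt_neqAle eq_sym an0.
have bp : 0 < coord_sum b by rewrite lt_neqAle eq_sym bn0.
have cp : 0 < c by rewrite -sab addr_gt0.
have sol (e : 'M[R]_(m, d)) : (forall i j, 0 <= e i j) -> P e -> 0 < coord_sum e ->
    solution_space P ((coord_sum e)^-1 *: e).
  move=> e0 Pe ep; split; last exact: PZ.
    by move=> i j; rewrite mxE mulr_ge0 // invr_ge0 ltW.
  by rewrite coord_sumZ mulVf // gt_eqF.
have [||||<- _] := ext ((coord_sum a)^-1 *: a) ((coord_sum b)^-1 *: b) (coord_sum a / c).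
- exact: sol.
- exact: sol.
- by rewrite divr_gt0 //= ltr_pdivrMr // mul1r -sab ltrDl.
- have -> : 1 - coord_sum a / c = coord_sum b / c.
    by rewrite -[1](@divff _ c) ?gt_eqF // -mulrBl -{1}sab addrAC subrr add0r.
  rewrite !scalerA ![_ / c]mulrC -!mulrA !divff // !mulr1 -scalerDr abx.
  by rewrite scalerA mulVf ?scale1r // gt_eqF.
by rewrite scalerA divff // scale1r.
Qed.
End Polytopes.

(** * Quadrilateral vertex surfaces *)

Theorem lemma4p5 (R : realType) (n : nat) (T : triangulation n)
  (hT : compact_3manifold R (realization R T)) (S : set (realization R T))
  (hS : quad_vertex_surface S) :
  std_vertex_surface (canonical_part S).
Proof.
have [_ hausM _ _] := hT; have [nS vertS] := hS.
have nK := canonical_normal hausM nS.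
set K := canonical_part S in nK *; split=> //.
pose v : 'M[R]_(n, 4 + 3) := std_vector K.
pose q := quad_vector S.
have vr : rsubmx v = q by rewrite row_mxKr quad_vector_canonical.
have v0 i j : 0 <= v i j.
  by apply: mx_ge0_split => {i j} [i a|i k]; rewrite ?row_mxKl ?row_mxKr mxE ler0n.
have q0 i j : 0 <= q i j by rewrite mxE ler0n.
have mv : std_matching T v := normal_std_matching nK.
have gap (V : realization R T) : (exists i a, is_corner V i a) ->
    exists i a, is_corner V i a /\ lsubmx v i a = 0.
  move=> /(canonical_gap hausM nS) [i [a [Va c0]]]; exists i, a; split=> //.
  by rewrite row_mxKl mxE c0.
pose s := coord_sum v; pose w := coord_sum q.
have wp : 0 < w.
  rewrite lt_neqAle coord_sum_ge0 // andbT eq_sym; apply/eqP => w0.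
  have [[_ + _] _] := vertS; rewrite coord_sumZ -/q -/w w0 mulr0 => /esym/eqP.
  by rewrite oner_eq0.
have sp : 0 < s.
  apply: (lt_le_trans wp); rewrite /w /s -vr; apply: ler_sum => i _.
  rewrite [leRHS]big_split_ord /= -[leLHS]add0r lerD ?sumr_ge0 //.
  by apply: ler_sum => k _; rewrite mxE.
pose X := projective_image v; pose Q := projective_image q.
have XE : X = s^-1 *: v by [].
have X0 i j : 0 <= X i j by rewrite mxE mulr_ge0 // invr_ge0 ltW.
have X1 : coord_sum X = 1 by rewrite coord_sumZ mulVf // gt_eqF.
have mX : std_matching T X by apply: std_matchingZ.
have gapX (V : realization R T) : (exists i a, is_corner V i a) ->
    exists i a, is_corner V i a /\ lsubmx X i a = 0.
  by move=> /gap [i [a [Va c0]]]; exists i, a; split=> //; rewrite linearZ mxE c0 mulr0.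
have Xr : rsubmx X = (w / s) *: Q.
  by rewrite linearZ /= vr scalerA mulrAC divff ?mul1r // gt_eqF.
split=> // y z t [y0 y1 my] [z0 z1 mz] /andP[t0 t1] XE'.
have t'0 : 0 < 1 - t by rewrite subr_gt0.
pose a := t *: y; pose b := (1 - t) *: z.
have a0 i j : 0 <= a i j by rewrite mxE mulr_ge0 // ltW.
have b0 i j : 0 <= b i j by rewrite mxE mulr_ge0 // ltW.
have ma : std_matching T a by apply: std_matchingZ.
have mb : std_matching T b by apply: std_matchingZ.
have abX : a + b = X by [].
have ar : rsubmx a = coord_sum (rsubmx a) *: Q.
  apply: (extreme_ray (@quad_matchingZ R n T) vertS (b := rsubmx b) (c := w / s)).
  - by move=> i k; rewrite mxE.
  - by move=> i k; rewrite mxE.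
  - exact: quad_of_std_matching.
  - exact: quad_of_std_matching.
  - by rewrite -Xr -abX linearD.
(* The multiple of X that leaves a - al X without quadrilaterals. *)
pose al := coord_sum (rsubmx a) * (s / w).
have arX : rsubmx a = al *: rsubmx X.
  rewrite Xr scalerA /al -mulrA [_ / w * _]mulrA divfK ?gt_eqF //.
  by rewrite divff ?mulr1 // gt_eqF.
have brX : rsubmx b = (1 - al) *: rsubmx X.
  by rewrite scalerBl scale1r -arX -abX linearD addrC addKr.
have da := dominated_by_gap mX ma a0 arX gapX.
have db := dominated_by_gap mX mb b0 brX gapX.
have sum0 : (a - al *: X) + (b - (1 - al) *: X) = 0.
  by rewrite scalerBl scale1r addrACA abX -opprD subrKC subrr.
have aE : a = al *: X.
  apply/matrixP => i j; apply/eqP; rewrite -subr_eq0 eq_le; apply/andP; split.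
    have := db i j; have /matrixP/(_ i j) := sum0.
    by rewrite !mxE; lra.
  by have := da i j; rewrite !mxE.
have alE : al = t.
  have := congr1 (@coord_sum R n (4 + 3)) aE.
  by rewrite (coord_sumZ t y) (coord_sumZ al X) y1 X1 !mulr1.
have yX : y = X.
  apply: (@scalerI _ _ t); first by rewrite gt_eqF.
  by rewrite -/a aE alE.
split=> //; apply: (@scalerI _ _ (1 - t)); first by rewrite gt_eqF.
rewrite -/b; apply: (addrI a); rewrite abX /a yX -scalerDl.
by rewrite addrC subrK scale1r.
Qed.
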